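(* Let $M$ be a pseudoforest partial multiplication matrix, and let $\mathcal{C}\subseteq\mathsf{Grid}(M)$ be a permutation class. Then $\mathcal{C}$ is labelled well quasi-ordered if and only if there exists an integer $k$ such that every $M$-coil belonging to $\mathcal{C}$ has length at most $k$.
   Context: Permutations are identified with their plots $\{(i,\pi(i))\}$. $\sigma$ is contained in $\pi$ ($\sigma\le\pi$) if $\pi$ has a subsequence order-isomorphic to $\sigma$. A permutation class is a set of permutations closed under containment. A gridding matrix is a matrix with entries in $\{0,1,-1\}$. An $m\times n$ gridding matrix has $m$ columns and $n$ rows; its entry $M_{ij}$ is in column $i$ (counted from the left) and row $j$ (counted from the bottom). An $M$-gridding of a permutation $\pi$ of length $L$ is a choice of vertical lines $\tfrac12=v_0\le v_1\le\dots\le v_m=L+\tfrac12$ and horizontal lines $\tfrac12=h_0\le\dots\le h_n=L+\tfrac12$, not passing through points of $\pi$, such that for each cell $C_{ij}=\{(x,y):v_{i-1}<x<v_i,\ h_{j-1}<y<h_j\}$ the points of $\pi$ in $C_{ij}$ are absent if $M_{ij}=0$, form an increasing sequence if $M_{ij}=1$, and a decreasing sequence if $M_{ij}=-1$. A permutation together with an $M$-gridding is an $M$-gridded permutation $\pi^\#$; $\mathsf{Grid}(M)$ is the class of permutations having at least one $M$-gridding. The row-column graph $G_M$ is the bipartite graph on vertices $\{1,\dots,m\}\cup\{1',\dots,n'\}$ with an edge $ij'$ iff $M_{ij}\ne0$; each non-zero cell corresponds to an edge. $M$ is a pseudoforest if every connected component of $G_M$ contains at most one cycle. $M$ is a partial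 multiplication matrix if there are fixed sequences $c_1,\dots,c_m$ and $r_1,\dots,r_n$ in $\{\pm1\}$ with $M_{ij}=c_ir_j$ for every non-zero entry. Column $i$ is oriented left-to-right if $c_i=1$ and right-to-left if $c_i=-1$; row $j$ is oriented bottom-to-top if $r_j=1$ and top-to-bottom if $r_j=-1$. For an $M$-gridded permutation $\pi^\#$ the orientation digraph $D_{\pi^\#}$ has the points of $\pi^\#$ as vertices and an edge $x\to y$ whenever $x,y$ lie in a common column of cells and $x$ precedes $y$ in that column's horizontal orientation, or lie in a common row of cells and $x$ precedes $y$ in that row's vertical orientation. Coils: let $\ell$ be the length of a cycle of $G_M$. A gridded $M$-coil is an $M$-gridded permutation $\pi^\#$ of length $n>\ell$ for which there exist an ordering $v_1,\dots,v_n$ of its points and a labelling by $1,\dots,\ell$ of the $\ell$ cells corresponding to the edges of some cycle of $G_M$ of length $\ell$ such that: (C1) $v_i$ lies in the cell labelled $i \bmod \ell$ (residues taken in $\{1,\dots,\ell\}$) for all $1\le i\le n$; (C2) $v_{i-1}\to v_i$ for $1<i\le n$; (C3) $v_i\to v_{i-\ell-1}$ for $\ell+1<i\le n$; (C4) $v_{\ell+1}\to v_1$ (edges in $D_{\pi^\#}$). An $M$-coil is a permutation having an $M$-gridding that is a gridded $M$-coil; its length is its number of points. Well quasi-order: a quasi-order is wqo if every infinite sequence $x_1,x_2,\dots$ has $i<j$ with $x_i\le x_j$. For a quasi-order $(L,\le_L)$, an $L$-labelled permutation is a pair $(\pi,\ell_\pi)$ with $\ell_\pi$ a map from the points of $\pi$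 to $L$; $(\sigma,\ell_\sigma)\le(\pi,\ell_\pi)$ if some embedding of $\sigma$ in $\pi$ maps each point to a point with label $\ge_L$ its own label. A set of permutations $\mathcal{C}$ is labelled well quasi-ordered (lwqo) if the set of all $L$-labelled elements of $\mathcal{C}$ is wqo under this order for every wqo $(L,\le_L)$. *)

(* Defs.v *)
From mathcomp Require Import all_boot all_order all_algebra.
From Stdlib Require List.
Set Implicit Arguments. Unset Strict Implicit. Unset Printing Implicit Defensive.
Import GRing.Theory Num.Theory.

(* Permutations.  A permutation of length L is a sequence s of naturals that
   is a rearrangement of 0,...,L-1.  Its plot is {(p, nth 0 s p) | p < L}
   (0-based positions and values; this is the paper's plot shifted by -1 in
   both coordinates, which changes nothing order-theoretically).            *)
Definition is_perm (s : seq nat) : Prop := perm_eq s (iota 0 (size s)).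

Definition order_iso (a b : seq nat) : Prop :=
  size a = size b /\
  forall i j, i < size a -> j < size a ->
    (nth 0 a i < nth 0 a j) = (nth 0 b i < nth 0 b j).

Definition contained (sigma pi : seq nat) : Prop :=
  exists msk : bitseq, order_iso sigma (mask msk pi).

Definition perm_class (C : seq nat -> Prop) : Prop :=
  (forall s, C s -> is_perm s) /\
  (forall s t, C t -> is_perm s -> contained s t -> C s).

(* Gridding matrices.  M : 'M[int]_(m, n) has m columns and n rows; the
   entry  M i j  is in column i (0-based, from the left) and row j
   (0-based, from the bottom).                                            *)
Definition gridding_matrix m n (M : 'M[int]_(m, n)) : Prop :=
  forall i j, M i j \in [:: 0%R; 1%R; (-1)%R].

(* Griddings.  A vertical line value  v k = c  encodes the line at
   c + 1/2 (in the 0-based coordinates); v 0 = 0 and v m = L.  Column i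
   contains the positions p with  v i <= p < v (i+1).  Similarly for rows. *)
Definition incol (v : nat -> nat) (i p : nat) : bool := (v i <= p < v i.+1).
Definition inrow (h : nat -> nat) (j y : nat) : bool := (h j <= y < h j.+1).

Definition in_cell (v h : nat -> nat) (s : seq nat) (i j p : nat) : bool :=
  incol v i p && inrow h j (nth 0 s p).

Definition is_gridding m n (M : 'M[int]_(m, n)) (s : seq nat)
  (v h : nat -> nat) : Prop :=
  v 0 = 0 /\ v m = size s /\ (forall k, k < m -> v k <= v k.+1) /\
  h 0 = 0 /\ h n = size s /\ (forall k, k < n -> h k <= h k.+1) /\
  (forall (i : 'I_m) (j : 'I_n),
        (forall p, p < size s -> in_cell v h s i j p -> M i j != 0%R) /\
        (forall p q, p < q -> q < size s -> in_cell v h s i j p ->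
           in_cell v h s i j q ->
           ((M i j == 1%R) ==> (nth 0 s p < nth 0 s q)) &&
           ((M i j == (-1)%R) ==> (nth 0 s q < nth 0 s p)))).

Definition in_grid m n (M : 'M[int]_(m, n)) (s : seq nat) : Prop :=
  exists v h, is_gridding M s v h.

(* Row-column graph G_M: vertices are columns (inl) and rows (inr).        *)
Definition rcvert m n := ('I_m + 'I_n)%type.

Definition rc_adj m n (M : 'M[int]_(m, n)) : rel (rcvert m n) :=
  fun a b => match a, b with
             | inl i, inr j => M i j != 0%R
             | inr j, inl i => M i j != 0%R
             | _, _ => false
             end.

Definition is_gcycle m n (M : 'M[int]_(m, n)) (w : seq (rcvert m n)) : bool :=
  [&& 2 < size w, uniq w & cycle (rc_adj M) w].

Definition cycle_cells m n (w : seq (rcvert m n)) : {set 'I_m * 'I_n} :=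
  [set x : 'I_m * 'I_n |
     has (fun a => ((a == inl x.1) && (next w a == inr x.2)) ||
                   ((a == inr x.2) && (next w a == inl x.1))) w].

Definition pseudoforest m n (M : 'M[int]_(m, n)) : Prop :=
  forall w1 w2, is_gcycle M w1 -> is_gcycle M w2 ->
    (exists a b, a \in w1 /\ b \in w2 /\ connect (rc_adj M) a b) ->
    cycle_cells w1 = cycle_cells w2.

Definition pmm_with m n (M : 'M[int]_(m, n)) (c : 'I_m -> int)
  (r : 'I_n -> int) : Prop :=
  [/\ forall i, c i \in [:: 1%R; (-1)%R],
      forall j, r j \in [:: 1%R; (-1)%R] &
      forall i j, M i j != 0%R -> M i j = (c i * r j)%R].

Definition oedge m n (c : 'I_m -> int) (r : 'I_n -> int) (v h : nat -> nat)
  (s : seq nat) (p q : nat) : bool :=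
  [exists i : 'I_m, [&& incol v i p, incol v i q &
                        (if c i == 1%R then p < q else q < p)]] ||
  [exists j : 'I_n, [&& inrow h j (nth 0 s p), inrow h j (nth 0 s q) &
                        (if r j == 1%R then nth 0 s p < nth 0 s q
                         else nth 0 s q < nth 0 s p)]].

(* Gridded M-coil.  0-based: the ordering is o = [v_1; ...; v_N] and the
   labels are 0, ..., l-1 (label t  <->  paper's label t+1).             *)
Definition gridded_coil m n (M : 'M[int]_(m, n)) (c : 'I_m -> int)
  (r : 'I_n -> int) (s : seq nat) (v h : nat -> nat) : Prop :=
  exists (o : seq nat) (w : seq (rcvert m n)) (lab : nat -> 'I_m * 'I_n),
    let N := size s in
    let l := size w in
    is_gcycle M w /\ l < N /\ perm_eq o (iota 0 N) /\
        (forall t, t < l -> lab t \in cycle_cells w) /\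
        (forall x, x \in cycle_cells w -> exists2 t, t < l & lab t = x) /\
        (forall t u, t < l -> u < l -> lab t = lab u -> t = u) /\
        (forall t, t < N -> in_cell v h s (lab (t %% l)).1 (lab (t %% l)).2
                                    (nth 0 o t)) /\
        (forall t, 0 < t < N -> oedge c r v h s (nth 0 o t.-1) (nth 0 o t)) /\
        (forall t, l.+1 <= t < N ->
                   oedge c r v h s (nth 0 o t) (nth 0 o (t - l.+1))) /\
        oedge c r v h s (nth 0 o l) (nth 0 o 0).

Definition is_coil m n (M : 'M[int]_(m, n)) (c : 'I_m -> int)
  (r : 'I_n -> int) (s : seq nat) : Prop :=
  is_perm s /\ exists v h, is_gridding M s v h /\ gridded_coil M c r s v h.

Definition qo_on (A : Type) (P : A -> Prop) (le : A -> A -> Prop) : Prop :=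
  (forall x, P x -> le x x) /\
  (forall x y z, P x -> P y -> P z -> le x y -> le y z -> le x z).

Definition wqo_on (A : Type) (P : A -> Prop) (le : A -> A -> Prop) : Prop :=
  qo_on P le /\
  forall x : nat -> A, (forall k, P (x k)) ->
    exists i j, i < j /\ le (x i) (x j).

(* L-labelled permutations: a sequence of (value, label) pairs; the
   underlying permutation is  map fst x  and point p has label (nth p x).2 *)
Definition lcontained (L : Type) (leL : L -> L -> Prop)
  (x y : seq (nat * L)) : Prop :=
  exists msk : bitseq,
    order_iso (map fst x) (map fst (mask msk y)) /\
    List.Forall2 (fun a b => leL a.2 b.2) x (mask msk y).

Definition lwqo (C : seq nat -> Prop) : Prop :=
  forall (L : Type) (leL : L -> L -> Prop),
    wqo_on (fun _ => True) leL ->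
    wqo_on (fun x : seq (nat * L) => C (map fst x)) (lcontained leL).

(* Main.v *)
Require Import Defs.
From mathcomp Require Import all_boot all_order all_algebra.
From mathcomp Require Import zify.
From Stdlib Require Import Classical ClassicalEpsilon.
Set Implicit Arguments. Unset Strict Implicit. Unset Printing Implicit Defensive.
Import Order.TTheory GRing.Theory Num.Theory.

(* If long coils exist, mark in each coil the first and the last point and label
   every point by its cell and its residue.  An embedding of one coil into another
   sends the i-th point to a point of index at most i, so the last point of the
   shorter coil cannot reach the last point of the longer one.

   Conversely, a gridded permutation is the sequence of the strongly connected
   components of its orientation digraph, so by Higman's lemma it suffices to treat
   one component S.  If S is acyclic, it is a word over its cells.  Otherwise S meets
   every cell of a cycle of the row-column graph.  A shortest directed path from the
   last to the first point of one of these cells, e, winds around the cycle in one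
   direction and is a coil, so its length is bounded.  Let B be the line through
   which this path enters e.  Cutting e off B makes the digraph acyclic, and a point
   is given as its level the number of times it takes to enter e through B in order
   to reach it from the last point of e.  The number of levels is bounded; edges
   inside a level, and those entering or leaving e through B between consecutive
   levels, form an acyclic digraph, while all other edges are determined by the levels
   (and by the position relative to the last point of e).  Hence S is a word over a
   finite alphabet, and Higman's lemma applies again. *)

(** * Well quasi-orders *)

(** Points of one line are totally ordered, so a map that keeps cells and edges is an embedding, and
    a wrong direction between two images can only be a reversed edge. A word therefore suffices as a
    code as soon as every pair of letters either refers the direction to the order of the word or
    fixes it. The obstacle is a closed walk: no linear order carries all its edges, and those left
    out must be readable from finitely many letters. Counting entries through [B] achieves this
    because a point of [e] is entered from a point that also precedes, along [B], everything to
    which it exits; so exits undo entries. The last point of [e] is where the counting starts; it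
    need not have such an entry, which is why it is treated apart. Totality is also what turns
    shortest paths into coils: where a shortest path excludes a forward edge between two points of
    one line, the backward edge that a coil requires must be present. *)

Lemma fun_choice (A B : Type) (P : A -> B -> Prop) :
  (forall a, exists b, P a b) -> exists f, forall a, P a (f a).
Proof.
move=> H; exists (fun a => proj1_sig (constructive_indefinite_description _ (H a))).
by move=> a; case: constructive_indefinite_description.
Qed.

Lemma ex_least (P : nat -> Prop) :
  (exists n, P n) -> exists n, P n /\ forall k, k < n -> ~ P k.
Proof.
case=> n; elim/ltn_ind: n => n IH Pn.
case: (classic (exists2 k, k < n & P k)) => [[k kn Pk]|H]; first exact: (IH k).
by exists n; split=> // k kn Pk; apply: H; exists k.
Qed.

Section Good.
Variables (A : Type) (le : A -> A -> Prop).

Definition good (P : A -> Prop) : Prop :=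
  forall x : nat -> A, (forall k, P (x k)) -> exists i j, i < j /\ le (x i) (x j).

Lemma incr_ltn (g : nat -> nat) :
  (forall k, g k < g k.+1) -> forall i j, i < j -> g i < g j.
Proof.
move=> Hg i; elim=> // j IH; rewrite ltnS leq_eqVlt => /orP[/eqP->//|/IH H].
exact: ltn_trans H (Hg j).
Qed.

(** Infinitely many terms without a later term above them would form a bad sequence. Hence from some
    [n0] on every term has a later one above it, and [nx] chains these. *)
Lemma good_mono (P : A -> Prop) (x : nat -> A) :
  (forall a b c, le a b -> le b c -> le a c) -> good P -> (forall k, P (x k)) ->
  exists g : nat -> nat, (forall i j, i < j -> g i < g j) /\
    forall i j, i < j -> le (x (g i)) (x (g j)).
Proof.
move=> tr gP Px.
have [n0 Hn0] : exists n0, forall i, n0 <= i -> exists j, i < j /\ le (x i) (x j).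
  apply: NNPP => H.
  have /fun_choice[t Ht] : forall n, exists i, n <= i /\ forall j, i < j -> ~ le (x i) (x j).
    move=> n; apply: NNPP => Hn; apply: H; exists n => i ni; apply: NNPP => Hi.
    by apply: Hn; exists i; split=> // j ij lij; apply: Hi; exists j.
  pose y k := iter k (fun a => t a.+1) (t 0).
  have ylt k : y k < y k.+1 by case: (Ht (y k).+1).
  have yterm k j : y k < j -> ~ le (x (y k)) (x j).
    by case: k => [|k]; [case: (Ht 0) => _; apply | case: (Ht (y k).+1) => _; apply].
  have [i [j [ij lij]]] := gP (x \o y) (fun k => Px (y k)).
  exact: (yterm i (y j) (incr_ltn ylt ij)).
have /fun_choice[nx Hnx] : forall i, exists j, n0 <= i -> i < j /\ le (x i) (x j).
  move=> i; case: (leqP n0 i) => [/Hn0[j Hj]|_]; [by exists j | by exists 0].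
pose g k := iter k nx n0.
have gn0 k : n0 <= g k.
  by elim: k => //= k IH; exact: leq_trans IH (ltnW (Hnx _ IH).1).
have glt k : g k < g k.+1 by case: (Hnx _ (gn0 k)).
exists g; split; first exact: incr_ltn.
move=> i; elim=> // j IH; rewrite ltnS leq_eqVlt => /orP[/eqP->|/IH H].
  by case: (Hnx _ (gn0 j)).
by apply: tr H _; case: (Hnx _ (gn0 j)).
Qed.

Inductive subword : seq A -> seq A -> Prop :=
| subword_nil w : subword [::] w
| subword_skip a u w : subword u w -> subword u (a :: w)
| subword_cons a b u w : le a b -> subword u w -> subword (a :: u) (b :: w).

Lemma subword_index u w : subword u w ->
  exists g : nat -> nat, [/\ forall i, i < size u -> g i < size w,
    forall i j, i < j -> j < size u -> g i < g j &
    forall d d' i, i < size u -> le (nth d u i) (nth d' w (g i))].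
Proof.
elim=> {u w}[w|a u w _ [g [g1 g2 g3]]|a b u w ab _ [g [g1 g2 g3]]].
- by exists id.
- by exists (S \o g); split=> // i j ij ju; exact: g2.
exists (fun i => if i is i'.+1 then (g i').+1 else 0); split=> [[|i]//|[|i] [|j]//|d d' [|i]//].
- exact: g1.
- by rewrite !ltnS => ij ju; exact: g2.
- exact: g3.
Qed.

End Good.

(* Nash-Williams' minimal bad sequence argument. *)
Lemma higman (A : Type) (le : A -> A -> Prop) (P : A -> Prop) :
  (forall a b c, le a b -> le b c -> le a c) -> good le P ->
  good (subword le) (List.Forall P).
Proof.
move=> tr gP x0 Px0; apply: NNPP => H0.
pose bad x := (forall k, List.Forall P (x k)) /\
              forall i j, i < j -> ~ subword le (x i) (x j).
have bad0 : bad x0.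
  by split=> // i j ij s; apply: H0; exists i, j.
(* [nxt (n, x)] is, among the bad sequences that agree with [x] before [n], one whose term [n] is
   shortest. *)
have /fun_choice[nxt Hnxt] : forall p : nat * (nat -> seq A), exists y, bad p.2 ->
    [/\ bad y, forall i, i < p.1 -> y i = p.2 i &
        forall y', bad y' -> (forall i, i < p.1 -> y' i = p.2 i) ->
        size (y p.1) <= size (y' p.1)].
  move=> [n x] /=; case: (classic (bad x)) => [bx|nb]; last by exists x.
  have [|s [[y [by_ yx ys]] smin]] := @ex_least (fun s =>
      exists y, [/\ bad y, forall i, i < n -> y i = x i & size (y n) = s]).
    by exists (size (x n)), x.
  exists y => _; split=> // y' by' y'x.
  by rewrite ys leqNgt; apply/negP => /smin; apply; exists y'.
pose X := fix X n := if n is n'.+1 then nxt (n', X n') else x0.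
have bX n : bad (X n) by elim: n => //= n IH; case: (Hnxt (n, X n) IH).
have XS n i : i < n -> X n.+1 i = X n i.
  by move=> ltin; case: (Hnxt (n, X n) (bX n)) => _ /(_ i ltin).
pose z n := X n.+1 n.
have Xz n i : i < n -> X n i = z i.
  elim: n => // n IH; rewrite ltnS leq_eqVlt => /orP[/eqP->//|lin].
  by rewrite XS // IH.
have zbad : bad z.
  split=> [k|i j ij]; first exact: (bX k.+1).1.
  have Ez : X j.+1 i = z i by apply: Xz; exact: ltnW.
  by rewrite -Ez; exact: (bX j.+1).2.
have zmin n y : bad y -> (forall i, i < n -> y i = z i) -> size (z n) <= size (y n).
  move=> b_y yz; case: (Hnxt (n, X n) (bX n)) => _ _ /(_ y b_y); apply=> i lin.
  by rewrite yz //= Xz.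
have /fun_choice[at_ Hat] : forall n, exists p, z n = p.1 :: p.2.
  move=> n; case E: (z n) => [|a t]; last by exists (a, t).
  by case: (zbad.2 n n.+1 (ltnSn n)); rewrite E; constructor.
have Pz k := zbad.1 k.
have Pa k : P (at_ k).1 by move: (Pz k); rewrite Hat => F; inversion F.
have Pt k : List.Forall P (at_ k).2 by move: (Pz k); rewrite Hat => F; inversion F.
have [g [gi gle]] := good_mono tr gP Pa.
(* The heads of the words [z (g k)] increase. Their tails, put after the terms of [z] before [g 0],
   would form a bad sequence with a shorter term at [g 0]. *)
pose y i := if i < g 0 then z i else (at_ (g (i - g 0))).2.
have g0 i : g 0 <= g i by case: i => // i; apply: ltnW; exact: gi.
suff: bad y.
  move=> /(zmin (g 0)); rewrite /y ltnn subnn Hat /= ltnn => F.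
  by suff: false by []; apply: F => i ->.
split=> [k|i j ij]; first by rewrite /y; case: ifP.
rewrite /y; case: ltnP => [ig|gi0]; case: ltnP => [jg|gj].
- exact: zbad.2.
- move=> s; apply: (zbad.2 i (g (j - g 0))); first exact: leq_trans ig (g0 _).
  by rewrite (Hat (g _)); constructor.
- by rewrite ltnNge (leq_trans gi0 (ltnW ij)) in jg.
- move=> s; have ij' : i - g 0 < j - g 0 by lia.
  apply: (zbad.2 _ _ (gi _ _ ij')); rewrite !Hat; apply: subword_cons => //.
  exact: gle.
Qed.

Lemma good_fin (Q : finType) : good (@eq Q) (fun _ => True).
Proof.
move=> x _; pose f (i : 'I_#|Q|.+1) := x i.
have /injectivePn[i [j nij fij]] : ~~ injectiveb f.
  apply/negP => /injectiveP/leq_card; rewrite card_ord ltnn //.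
have /orP[lij|lij] : (i < j) || (j < i) by rewrite -neq_ltn.
- by exists i, j.
- by exists j, i.
Qed.

Lemma good_fin_pair (Q : finType) (A : Type) (le : A -> A -> Prop) :
  (forall a b c, le a b -> le b c -> le a c) -> good le (fun _ => True) ->
  good (fun a b : Q * A => a.1 = b.1 /\ le a.2 b.2) (fun _ => True).
Proof.
move=> tr gA x _.
have [g [gi gle]] := good_mono tr gA (fun k => I : (fun _ => True) ((x k).2)).
have [i [j [ij e]]] := @good_fin Q (fun k => (x (g k)).1) (fun _ => I).
by exists (g i), (g j); split; [exact: gi | split=> //; exact: gle].
Qed.

(** * Cycles and walks in the row-column graph *)

Section RowColumnGraph.
Variables (m n : nat) (M : 'M[int]_(m, n)).
Local Notation V := (rcvert m n).
Local Notation cell := ('I_m * 'I_n)%type.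

Definition ends (a b : V) (e : cell) : bool :=
  ((a == inl e.1) && (b == inr e.2)) || ((a == inr e.2) && (b == inl e.1)).

Lemma endsC a b e : ends a b e = ends b a e.
Proof. by rewrite /ends orbC andbC [X in _ || X]andbC. Qed.

Lemma rc_adjP a b : reflect (exists2 e, ends a b e & M e.1 e.2 != 0%R) (rc_adj M a b).
Proof.
apply: (iffP idP).
  case: a b => [i|j] [i'|j'] //= H.
    by exists (i, j') => //; rewrite /ends /= !eqxx.
  by exists (i', j) => //; rewrite /ends /= !eqxx.
by case=> [[i j]] /= /orP[] /andP[/eqP-> /eqP->].
Qed.

Lemma rc_adj_sym : symmetric (rc_adj M).
Proof. by move=> [i|j] [i'|j']. Qed.

Lemma rc_adj_irrefl a : rc_adj M a a = false.
Proof. by case: a. Qed.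

Lemma ends_inj a b e e' : ends a b e -> ends a b e' -> e = e'.
Proof.
case: e e' => [i j] [i' j'].
by case/orP=> /andP[/eqP-> /eqP->] /orP[] /andP[] //= /eqP[->] /eqP[->].
Qed.

Lemma ends_pair a b a' b' e : ends a b e -> ends a' b' e ->
  (a = a' /\ b = b') \/ (a = b' /\ b = a').
Proof.
by case/orP=> /andP[/eqP-> /eqP->] /orP[] /andP[/eqP-> /eqP->]; [left|right|right|left].
Qed.

Lemma ends_neq a b e : ends a b e -> a <> b.
Proof. by case/orP=> /andP[/eqP-> /eqP->]. Qed.

(** * Cycles given by periodic vertex functions *)

Section FunCycle.
Variables (L : nat -> V) (N : nat).
Hypotheses (N2 : 2 < N) (LN : L N = L 0)
  (Linj : forall i j, i < N -> j < N -> L i = L j -> i = j)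
  (Ladj : forall i, i < N -> rc_adj M (L i) (L i.+1)).

Lemma uniq_fun_cycle : uniq (mkseq L N).
Proof.
by rewrite map_inj_in_uniq ?iota_uniq // => i j; rewrite !mem_iota => ? ?; apply: Linj.
Qed.

Lemma fun_cycle : is_gcycle M (mkseq L N).
Proof.
rewrite /is_gcycle size_mkseq N2 uniq_fun_cycle /=.
case: N N2 LN Ladj => // k _ Lk adj; rewrite /mkseq /= -Lk.
rewrite -map_rcons (_ : rcons _ _ = iota 1 k.+1); last first.
  by rewrite -cats1 -(addn1 k) iotaD add1n addn1.
apply/(pathP (L 0)) => i; rewrite size_map size_iota => ik.
rewrite (nth_map 0) ?size_iota // nth_iota // Lk.
case: i ik => [|i] ik; first exact: adj.
rewrite -[nth _ (_ :: _) _]/(nth (L 0) [seq L i | i <- iota 1 k.+1] i).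
by rewrite (nth_map 0) ?size_iota 1?ltnW // nth_iota 1?ltnW //; exact: adj.
Qed.

Lemma next_fun_cycle i : i < N -> next (mkseq L N) (L i) = L i.+1.
Proof.
move=> iN; rewrite next_nth map_f ?mem_iota //=.
have -> : index (L i) (mkseq L N) = i.
  by rewrite -{1}(nth_mkseq (L 0) L iN) index_uniq ?size_mkseq ?uniq_fun_cycle.
case: N N2 LN iN => // k _ Lk ik; rewrite /mkseq /=.
move: ik; rewrite ltnS leq_eqVlt => /orP[/eqP->|ik].
  by rewrite nth_default ?size_map ?size_iota.
by rewrite (nth_map 0) ?size_iota // nth_iota.
Qed.

Lemma fun_cycle_cells e :
  reflect (exists2 i, i < N & ends (L i) (L i.+1) e) (e \in cycle_cells (mkseq L N)).
Proof.
rewrite inE; apply: (iffP hasP) => [[a /mapP[i]]|[i iN ie]].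
  by rewrite mem_iota => /andP[_ iN] ->; rewrite next_fun_cycle // => ie; exists i.
exists (L i); first by rewrite map_f ?mem_iota.
by rewrite next_fun_cycle.
Qed.

(** The same edge could be crossed twice, in opposite directions, only in a closed walk of length 2,
    which [N2] excludes. *)
Lemma ends_fun_inj e i j : i < N -> j < N ->
  ends (L i) (L i.+1) e -> ends (L j) (L j.+1) e -> i = j.
Proof.
move=> iN jN ie je; case: (ends_pair ie je) => [[Eij _]|[Eij Eji]]; first exact: Linj.
have [iN1|iN1] := ltnP i.+1 N; have [jN1|jN1] := ltnP j.+1 N.
- by have := Linj iN jN1 Eij; have := Linj iN1 jN Eji; lia.
- have Ej : j.+1 = N by lia.
  rewrite Ej LN in Eij; have := Linj iN (ltn_trans (ltn0Sn _) N2) Eij.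
  by have := Linj iN1 jN Eji; lia.
- have Ei : i.+1 = N by lia.
  rewrite Ei LN in Eji; have := Linj (ltn_trans (ltn0Sn _) N2) jN Eji.
  by have := Linj iN jN1 Eij; lia.
- lia.
Qed.

(** Cycles with the same cells thus have the same length, even when found from different starting
    vertices. *)
Lemma card_fun_cycle_cells : #|cycle_cells (mkseq L N)| = N.
Proof.
have [c Hc] : exists c : 'I_N -> cell, forall i : 'I_N, ends (L i) (L i.+1) (c i).
  apply: (@fin_all_exists 'I_N (fun _ => cell) (fun (i : 'I_N) e => ends (L i) (L i.+1) e)) => i.
  by case/rc_adjP: (Ladj (ltn_ord i)) => e; exists e.
have cI : injective c.
  move=> i j Eij; apply: val_inj; apply: (ends_fun_inj (ltn_ord i) (ltn_ord j) (Hc i)).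
  by rewrite Eij.
rewrite -{2}(card_ord N) -(card_codom cI); apply: eq_card => e.
apply/fun_cycle_cells/codomP => [[i iN ie]|[i ->]]; last by exists i.
by exists (Ordinal iN); apply: ends_inj ie (Hc (Ordinal iN)).
Qed.

End FunCycle.

Hypothesis pf : pseudoforest M.

Lemma cycle_cells_mem (w : seq V) e : e \in cycle_cells w -> inl e.1 \in w.
Proof.
by rewrite inE => /hasP[a aw] /orP[] /andP[/eqP Ea /eqP Eb]; rewrite -?Ea // -Eb mem_next.
Qed.

Lemma connect_walk (A : nat -> V) k i j : (forall i, i < k -> rc_adj M (A i) (A i.+1)) ->
  i <= j -> j <= k -> connect (rc_adj M) (A i) (A j).
Proof.
move=> adj; elim: j => [|j IH]; first by rewrite leqn0 => /eqP->.
rewrite leq_eqVlt => /orP[/eqP->//|ij] jk.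
exact: connect_trans (IH ij (ltnW jk)) (connect1 (adj _ jk)).
Qed.

(* In a pseudoforest, a non-backtracking walk whose first edge lies on a cycle
   can only repeat a vertex by running around that cycle. *)
Lemma walk_first_repeat (A : nat -> V) k (w : seq V) e :
  (forall i, i < k -> rc_adj M (A i) (A i.+1)) ->
  (forall i, i.+2 <= k -> A i <> A i.+2) ->
  (exists i j, i < j <= k /\ A i = A j) ->
  is_gcycle M w -> e \in cycle_cells w -> ends (A 0) (A 1) e ->
  exists j, [/\ 2 < j, j <= k, A j = A 0,
    forall a b, a < j -> b < j -> A a = A b -> a = b &
    cycle_cells (mkseq A j) = cycle_cells w].
Proof.
move=> adj nb rep wc ew e01.
have [|j [[i [ij jk Eij]] jmin]] := @ex_least (fun j => exists i, [/\ i < j, j <= k & A i = A j]).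
  by case: rep => i [j [/andP[ij jk] E]]; exists j, i.
have inj a b : a < j -> b < j -> A a = A b -> a = b.
  move=> aj bj E; case: (ltngtP a b) => // lab.
    by case: (jmin b bj); exists a; split=> //; apply: leq_trans jk; apply: ltnW.
  by case: (jmin a aj); exists b; split=> //; apply: leq_trans jk; apply: ltnW.
pose L s := A (i + s); pose N := j - i.
have LN : L N = L 0 by rewrite /L /N addn0 subnKC // ltnW.
have Ladj s : s < N -> rc_adj M (L s) (L s.+1).
  by rewrite /L /N => sN; rewrite addnS; apply: adj; lia.
have Linj a b : a < N -> b < N -> L a = L b -> a = b.
  rewrite /L /N => aN bN /inj H; apply/eqP; rewrite -(eqn_add2l i); apply/eqP; apply: H; lia.
have N2 : 2 < N.
  rewrite /N; case E: (j - i) => [|[|[|]]] //; first lia.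
    have Ej : j = i.+1 by lia.
    have ik : i < k by lia.
    by have := adj i ik; rewrite -Ej -Eij rc_adj_irrefl.
  have Ej : j = i.+2 by lia.
  by case: (nb i); rewrite -?Ej.
have gc := fun_cycle N2 LN Linj Ladj.
have Ecc : cycle_cells (mkseq L N) = cycle_cells w.
  apply: pf => //; exists (A i), (inl e.1).
  split; first by apply/mapP; exists 0; rewrite ?mem_iota /L ?addn0 //; lia.
  split; first exact: cycle_cells_mem ew.
  rewrite (sym_connect_sym rc_adj_sym).
  have c0i : connect (rc_adj M) (A 0) (A i) by apply: (@connect_walk _ k) => //; lia.
  have c1 : connect (rc_adj M) (A 1) (A 0).
    by apply: connect1; rewrite rc_adj_sym; apply: adj; lia.
  case/orP: e01 => /andP[/eqP E0 /eqP E1]; rewrite -?E0 -?E1 //.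
  exact: connect_trans c0i.
(* The loop has the cells of [w], so it crosses [e]. As the vertices before [j] are distinct, this
   crossing is the first step of the walk, and the loop begins at 0. *)
have i0 : i = 0.
  move: ew; rewrite -Ecc => /(fun_cycle_cells N2 LN Linj)[s sN]; rewrite /L addnS => es.
  have j2 : 2 < j by lia.
  have j0 : 0 < j by lia.
  have j1 : 1 < j by lia.
  have isj : i + s < j by rewrite /N in sN; lia.
  case: (ends_pair e01 es) => [[E0 E1]|[E0 E1]].
    by have := inj _ _ j0 isj E0; lia.
  have H1 := inj _ _ j1 isj E1.
  have [isj1|isj1] := ltnP (i + s).+1 j; first by have := inj _ _ j0 isj1 E0; lia.
  lia.
subst i; exists j; split=> //; first by rewrite /N subn0 in N2.
by rewrite -Ecc /N subn0.
Qed.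

(** By induction on [t], the suffix from [t] starts on an edge of the cycle. It repeats a vertex,
    since the last vertex of the walk is an end of [e] and is already met during the lap from [t].
    So [walk_first_repeat] brings it back to [A t], and the lap has length [l] because it has the
    same cells. *)
Lemma walk_periodic (A : nat -> V) k (w : seq V) e :
  (forall i, i <= k -> rc_adj M (A i) (A i.+1)) ->
  (forall i, i < k -> A i <> A i.+2) -> 1 < k ->
  is_gcycle M w -> e \in cycle_cells w -> ends (A 0) (A 1) e -> ends (A k) (A k.+1) e ->
  exists l, [/\ 2 < l, l <= k,
    forall a b, a < l -> b < l -> A a = A b -> a = b,
    cycle_cells (mkseq A l) = cycle_cells w &
    forall t, t + l <= k.+1 -> A (t + l) = A t].
Proof.
move=> adj nb k1 wc ew e0 ek.
have Ak : (A k = A 0 /\ A k.+1 = A 1) \/ (A k = A 1 /\ A k.+1 = A 0).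
  by case: (ends_pair ek e0) => [[]|[]]; [left|right].
have [|l [l2 lk1 Al inj Ecc]] := walk_first_repeat (k := k.+1) adj nb _ wc ew e0.
  by case: Ak => [[E _]|[E _]]; [exists 0, k|exists 1, k]; rewrite E; split=> //; lia.
have lk : l <= k.
  rewrite leqNgt; apply/negP => kl; have El : l = k.+1 by lia.
  have [l0 l1 kl'] : [/\ 0 < l, 1 < l & k < l] by split; lia.
  case: Ak => [[E _]|[E _]].
    by have := inj _ _ l0 kl' (esym E); lia.
  by have := inj _ _ l1 kl' (esym E); lia.
exists l; split=> //.
elim/ltn_ind=> t IH tl.
have Amod s : s < t + l -> A s = A (s %% l).
  elim/ltn_ind: s => s IHs sl; have [ls|ls] := ltnP s l; first by rewrite modn_small.
  rewrite -(subnK ls) modnDr IH; [|lia|lia].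
  by apply: IHs; lia.
case: (posnP t) => [->//|t0].
have [e' et ew'] : exists2 e', ends (A t) (A t.+1) e' & e' \in cycle_cells w.
  have tl' : t %% l < l by rewrite ltn_mod; lia.
  have At : A t = A (t %% l) by apply: Amod; lia.
  have At1 : A t.+1 = A (t %% l).+1.
    rewrite Amod; last by lia.
    rewrite -addn1 -modnDml addn1; move: tl'; rewrite leq_eqVlt => /orP[/eqP->|/modn_small->//].
    by rewrite modnn Al.
  have /rc_adjP[e' E' _] : rc_adj M (A t) (A t.+1) by apply: adj; lia.
  exists e' => //; rewrite -Ecc.
  apply/(fun_cycle_cells l2 Al inj); exists (t %% l) => //; by rewrite -At -At1.
have [b [b1 Eb]] : exists b, b <= 1 /\ A k.+1 = A b.
  by case: Ak => [[_ E]|[_ E]]; [exists 1|exists 0].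
have [s [ts stl Es]] : exists s, [/\ t <= s, s < t + l & A s = A b].
  have bl : b < l by lia.
  (* The first index from [t] on that is congruent to [b] modulo [l]. *)
  pose s0 := t + ((b + (l - t %% l)) %% l).
  have ml : (b + (l - t %% l)) %% l < l by rewrite ltn_mod; lia.
  exists s0; rewrite /s0; split; [lia|lia|].
  rewrite Amod; last by lia.
  rewrite modnDmr -modnDml addnCA subnKC; last by rewrite ltnW // ltn_mod; lia.
  by rewrite modnDr modn_small.
have et' : ends (A (t + 0)) (A (t + 1)) e' by rewrite addn0 addn1.
have [|||j [j2 jk Aj injj Ej]] :=
  @walk_first_repeat (fun i => A (t + i)) (k.+1 - t) w e' _ _ _ wc ew' et'.
- by move=> i ik; rewrite addnS; apply: adj; lia.
- by move=> i ik; rewrite !addnS; apply: nb; lia.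
- exists (s - t), (k.+1 - t); split; first by lia.
  by rewrite !subnKC; [rewrite Es| lia | lia].
suff <- : j = l by rewrite addn0 in Aj.
have H1 : #|cycle_cells (mkseq (fun i => A (t + i)) j)| = j.
  apply: card_fun_cycle_cells => // i ij; rewrite addnS; apply: adj; lia.
have H2 : #|cycle_cells (mkseq A l)| = l.
  apply: card_fun_cycle_cells => // i ij; apply: adj; lia.
by rewrite -H1 Ej -Ecc H2.
Qed.

End RowColumnGraph.

(** * Gridded point sets and their orientation digraph *)

Section FiniteRelations.
Variables (T : finType) (R : rel T).

Lemma connect_fun x y : connect R x y ->
  exists (N : nat) (P : nat -> T), [/\ P 0 = x, P N = y & forall i, i < N -> R (P i) (P i.+1)].
Proof.
case/connectP=> p pth ->; exists (size p), (nth x (x :: p)); split=> //.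
  by rewrite -last_nth.
by move=> i ip; exact: (pathP x pth).
Qed.

Lemma connect_induced_path x y : connect R x y ->
  exists (N : nat) (P : nat -> T), [/\ P 0 = x, P N = y,
    forall i, i < N -> R (P i) (P i.+1),
    forall i j, i < j -> j < N -> ~~ R (P i) (P j.+1) &
    forall i j, i < j -> j <= N -> P i <> P j].
Proof.
move=> /connect_fun cxy.
have [//|N [[P [P0 PN PR]] Nmin]] := @ex_least (fun N => exists P : nat -> T,
  [/\ P 0 = x, P N = y & forall i, i < N -> R (P i) (P i.+1)]).
exists N, P; split=> // i j ij jN; [apply/negP => Rij|move=> Eij].
  apply: (Nmin (N - (j - i))); first by lia.
  exists (fun k => if k <= i then P k else P (k + (j - i))); split=> //.
    have -> : (N - (j - i) <= i) = false by lia.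
    by rewrite subnK //; lia.
  move=> k kN; case: (ltngtP k i) => [ki|ki|->].
  - by apply: PR; lia.
  - by rewrite addSn; apply: PR; lia.
  - by rewrite (_ : i.+1 + (j - i) = j.+1) //; lia.
apply: (Nmin (N - (j - i))); first by lia.
exists (fun k => if k <= i then P k else P (k + (j - i))); split=> //.
  case: leqP => [Ni|iN]; last by rewrite subnK //; lia.
  have -> : N - (j - i) = i by lia.
  by rewrite Eij -PN; congr P; lia.
move=> k kN; case: (ltngtP k i) => [ki|ki|Eki].
- by apply: PR; lia.
- by rewrite addSn; apply: PR; lia.
- by rewrite Eki Eij (_ : i.+1 + (j - i) = j.+1); [apply: PR; lia|lia].
Qed.

Lemma induced_closed_walk x y : R x y -> connect R y x ->
  exists (N : nat) (P : nat -> T), [/\ 0 < N, P N = P 0,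
    forall i, i < N -> R (P i) (P i.+1) &
    forall i j, i < N -> j < N -> R (P i) (P j.+1) -> i = j].
Proof.
move=> Rxy /connect_fun cyx.
have [|N [[P [N0 PN PR]] Nmin]] := @ex_least (fun N => exists P : nat -> T,
  [/\ 0 < N, P N = P 0 & forall i, i < N -> R (P i) (P i.+1)]).
  case: cyx => N [P [P0 PN PR]]; exists N.+1, (fun i => if i is k.+1 then P k else x).
  by split=> // -[_|i iN]; [rewrite P0|exact: PR].
exists N, P; split=> // i j iN jN Rij; case: (ltngtP i j) => // lij.
  case: (Nmin (N - (j - i))); first by lia.
  exists (fun k => if k <= i then P k else P (k + (j - i))); split=> //; first by lia.
    have -> : (N - (j - i) <= i) = false by lia.
    by rewrite subnK //; lia.
  move=> k kN; case: (ltngtP k i) => [ki|ki|->].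
  - by apply: PR; lia.
  - by rewrite addSn; apply: PR; lia.
  - by rewrite (_ : i.+1 + (j - i) = j.+1) //; lia.
(* A backward chord closes the stretch from [P j.+1] to [P i] into a closed walk of length
   [i - j]. *)
case: (Nmin (i - j)); first by lia.
exists (fun k => if k == i - j then P j.+1 else P (k + j.+1)); split=> //; first by lia.
  by rewrite eqxx ifF ?add0n //; lia.
move=> k kN; rewrite ifF; last by lia.
case: eqP => [E|nE]; first by rewrite (_ : k + j.+1 = i) //; lia.
by rewrite addSn; apply: PR; lia.
Qed.

End FiniteRelations.

(** A gridded point set without grid lines: the keys are coordinates already turned into the
    orientation of column and row, so that every edge is a comparison of keys. *)
Record grd (m n : nat) := Grd {
  pt :> finType;
  col : pt -> 'I_m; row : pt -> 'I_n;
  xkey : pt -> int; ykey : pt -> int }.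

Section Gridded.
Variables (m n : nat).
Local Notation V := (rcvert m n).
Local Notation cell := ('I_m * 'I_n)%type.

Definition incid (e : cell) (L : V) : bool :=
  match L with inl i => e.1 == i | inr j => e.2 == j end.

Definition opposite (e : cell) (L : V) : V :=
  match L with inl _ => inr e.2 | inr _ => inl e.1 end.

Lemma ends_opposite e L : incid e L -> ends L (opposite e L) e.
Proof. by case: L => i /eqP <-; rewrite /ends /= !eqxx. Qed.

Lemma ends_incid a b e : ends a b e -> incid e a /\ incid e b.
Proof. by case/orP=> /andP[/eqP-> /eqP->]; rewrite /= !eqxx. Qed.

Lemma incid_ends a b e : incid e a -> incid e b -> a <> b -> ends a b e.
Proof.
by case: a b => [i|j] [i'|j'] /= /eqP<- /eqP<- // _; rewrite /ends /= !eqxx.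
Qed.

Lemma ends_cases a b e L : ends a b e -> incid e L -> L = a \/ L = b.
Proof.
by case/orP=> /andP[/eqP-> /eqP->]; case: L => i /= /eqP<-; [left|right|right|left].
Qed.

Variable G : grd m n.
Implicit Types p q : G.

Definition cellof p : cell := (col p, row p).
Definition on p (L : V) := incid (cellof p) L.
Definition key (L : V) p := match L with inl _ => xkey p | inr _ => ykey p end.
Definition before L p q := [&& on p L, on q L & (key L p < key L q)%R].
Definition edge p q := [exists L, before L p q].

(** [key_agree] is the partial multiplication condition: inside a cell the orientations of its
    column and its row give the same order. *)
Record wf (M : 'M[int]_(m, n)) : Prop := Wf {
  key_inj : forall L p q, on p L -> on q L -> key L p = key L q -> p = q;
  key_agree : forall p q, cellof p = cellof q -> (xkey p < xkey q)%R = (ykey p < ykey q)%R;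
  cell_nz : forall p, M (col p) (row p) != 0%R }.

Variable M : 'M[int]_(m, n).
Hypothesis W : wf M.

Lemma before_trans L p q r : before L p q -> before L q r -> before L p r.
Proof.
by case/and3P=> pL qL pq /and3P[_ rL qr]; rewrite /before pL rL (lt_trans pq qr).
Qed.

Lemma before_edge L p q : before L p q -> edge p q.
Proof. by move=> H; apply/existsP; exists L. Qed.

Lemma key_cell L L' p q : cellof p = cellof q -> (key L p < key L q)%R = (key L' p < key L' q)%R.
Proof. by move/(key_agree W) => E; case: L L' => i [] j. Qed.

Lemma before_cell L L' p q : cellof p = cellof q -> before L p q -> on p L' -> before L' p q.
Proof.
move=> E /and3P[pL qL pq] pL'; rewrite /before pL' -(key_cell L) // pq andbT.
by rewrite /on -E.
Qed.

Lemma on_two_cell L L' p q : L <> L' -> on p L -> on p L' -> on q L -> on q L' ->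
  cellof p = cellof q.
Proof.
move=> nL pL pL' qL qL'.
exact: ends_inj (incid_ends pL pL' nL) (incid_ends qL qL' nL).
Qed.

Lemma before_asym L L' p q : before L p q -> before L' q p -> False.
Proof.
move=> H H'; have pq : cellof p = cellof q -> False.
  move=> E; have/and3P[_ qL' _] := H'.
  have /and3P[_ _ h] := H; have /and3P[_ _ h'] := H'.
  by move: h'; rewrite (key_cell L' L) // => /(lt_trans h); rewrite ltxx.
case: (eqVneq L L') => [E|/eqP nL].
  by subst L'; have := before_trans H H'; rewrite /before ltxx !andbF.
case/and3P: H H' => pL qL _ /and3P[qL' pL' _].
exact/pq/(on_two_cell nL).
Qed.

Lemma edge_irrefl p : edge p p = false.
Proof. by apply/existsP => -[L /and3P[_ _]]; rewrite ltxx. Qed.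

Lemma edge_asym p q : edge p q -> edge q p -> False.
Proof. by case/existsP=> L H /existsP[L']; exact: (before_asym H). Qed.

Lemma before_total L p q : on p L -> on q L -> p <> q -> before L p q \/ before L q p.
Proof.
move=> pL qL npq; rewrite /before pL qL /=.
case: (ltgtP (key L p) (key L q)) => // [|| E]; [by left|by right|].
by case: npq; exact: (key_inj W pL qL E).
Qed.

Lemma edge_on L p q : on p L -> on q L -> edge p q -> before L p q.
Proof.
move=> pL qL E; case: (eqVneq p q) E => [->|/eqP npq]; first by rewrite edge_irrefl.
case: (before_total pL qL npq) => // /before_edge H H'; case: (edge_asym H' H).
Qed.

(* With [o = Some (L, e)], the edges of the line [L] between the cell [e] and the
   other cells are dropped. *)
Definition detached (o : option (V * cell)) L e := o == Some (L, e).

Lemma detached_inj o L e e' : detached o L e -> detached o L e' -> e = e'.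
Proof. by move/eqP-> => /eqP[]. Qed.

Definition sedge (S : {set G}) o p q :=
  [&& p \in S, q \in S & [exists L, before L p q &&
    (detached o L (cellof p) == detached o L (cellof q))]].

Lemma sedgeP (S : {set G}) o p q : reflect [/\ p \in S, q \in S & exists2 L, before L p q &
    detached o L (cellof p) = detached o L (cellof q)] (sedge S o p q).
Proof.
apply: (iffP and3P) => [[pS qS /existsP[L /andP[H /eqP E]]]|[pS qS [L H E]]].
  by split=> //; exists L.
by split=> //; apply/existsP; exists L; rewrite H E eqxx.
Qed.

Lemma sedge_edge (S : {set G}) o p q : sedge S o p q -> edge p q.
Proof. by case/sedgeP=> _ _ [L /before_edge]. Qed.

Lemma sedge_None (S : {set G}) p q : sedge S None p q = [&& p \in S, q \in S & edge p q].
Proof.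
apply/sedgeP/and3P => [[pS qS [L /before_edge]]|[pS qS /existsP[L H]]] //.
by split=> //; exists L.
Qed.

(* A shortest closed walk uses every line at most once, so its lines form a
   cycle of the row-column graph. *)
Lemma closed_walk_gcycle (S : {set G}) o x y : sedge S o x y -> connect (sedge S o) y x ->
  exists w, [/\ is_gcycle M w, exists e, e \in cycle_cells w,
    forall e, e \in cycle_cells w -> exists2 p, p \in S & cellof p = e &
    forall L e, o = Some (L, e) -> incid e L -> e \notin cycle_cells w].
Proof.
move=> Rxy /(induced_closed_walk Rxy)[N [P [N0 PN PR chord]]].
have N2 : 2 < N.
  case: N N0 PN PR chord => [|[|[|]]] //= _ PN PR _.
    by have := sedge_edge (PR 0 isT); rewrite PN edge_irrefl.
  have E1 := sedge_edge (PR 0 isT); have := sedge_edge (PR 1 isT).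
  by rewrite PN => E2; case: (edge_asym E1 E2).
have /fun_choice[ln Hln] : forall i, exists L, i < N -> before L (P i) (P i.+1) /\
    detached o L (cellof (P i)) = detached o L (cellof (P i.+1)).
  move=> i; case: (ltnP i N) => [/PR/sedgeP[_ _ [L H E]]|_]; first by exists L.
  by exists (inl (col x)).
pose s i := i.+1 %% N.
have sN i : s i < N by rewrite ltn_mod.
have Ps i : i < N -> P (s i) = P i.+1.
  by rewrite /s leq_eqVlt => /orP[/eqP->|/modn_small->//]; rewrite modnn PN.
have sneq i : i < N -> i <> s i.
  by rewrite /s leq_eqVlt => /orP[/eqP E|/modn_small->]; rewrite ?E ?modnn; lia.
have PS i : i < N -> P i \in S by move=> /PR/sedgeP[].
have PS1 i : i < N -> P i.+1 \in S by move=> /PR/sedgeP[].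
(* A step inside one cell could be merged with the next step, on whose line both its points lie. *)
have diffcell i : i < N -> cellof (P i) <> cellof (P i.+1).
  move=> iN E; have [H1 _] := Hln i iN; have [H2 D2] := Hln (s i) (sN i).
  rewrite Ps // in H2 D2; apply: (sneq i iN); apply: chord => //.
  apply/sedgeP; split; [exact: PS|exact: PS1|exists (ln (s i)); last by rewrite E].
  apply: (before_trans _ H2); apply: (before_cell _ H1) => //.
  by case/and3P: H2 => H2 _ _; rewrite /on E.
(* If steps [i] and [j] use the same line, then there [P i] precedes [P j.+1] or [P j] precedes
   [P i.+1]; either is a chord. No step has detached ends, since both would lie in one cell, so the
   cut does not remove these chords. *)
have lninj i j : i < N -> j < N -> ln i = ln j -> i = j.
  move=> iN jN E; have [H1 D1] := Hln i iN; have [H2 D2] := Hln j jN.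
  have ED : detached o (ln i) (cellof (P i)) = detached o (ln j) (cellof (P j)).
    case Ei: (detached _ _ _); case Ej: (detached _ _ _) => //.
      by case: (diffcell i iN); apply: (detached_inj Ei); rewrite -D1.
    by case: (diffcell j jN); apply: (detached_inj Ej); rewrite -D2.
  have [H|H] := ltP (key (ln i) (P i)) (key (ln i) (P j.+1)).
    apply: chord => //; apply/sedgeP; split; [exact: PS|exact: PS1|].
    exists (ln i); last by rewrite ED D2 E.
    case/and3P: H1 => H1 _ _; case/and3P: H2 => _; rewrite -E => HH _.
    by rewrite /before H1 HH H.
  apply/esym; apply: chord => //; apply/sedgeP; split; [exact: PS|exact: PS1|].
  exists (ln i); last by rewrite -D1 ED E.
  case/and3P: H1 => _ H1 H1'; case/and3P: H2; rewrite -E => H2 _ H2'.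
  rewrite /before H2 H1 /=; exact: lt_trans H2' (le_lt_trans H H1').
pose L i := ln (i %% N).
have Lln i : i < N -> L i = ln i by move=> iN; rewrite /L modn_small.
have Lends i : i < N -> ends (L i) (L i.+1) (cellof (P i.+1)).
  move=> iN; rewrite Lln // /L -/(s i); apply: incid_ends.
  - by have [/and3P[]] := Hln i iN.
  - by have [/and3P[]] := Hln (s i) (sN i); rewrite Ps.
  - by move/(lninj _ _ iN (sN i))/(sneq i iN).
have LN : L N = L 0 by rewrite /L modnn mod0n.
have Linj i j : i < N -> j < N -> L i = L j -> i = j.
  by move=> iN jN; rewrite !Lln //; exact: lninj.
have Ladj i : i < N -> rc_adj M (L i) (L i.+1).
  by move=> iN; apply/rc_adjP; exists (cellof (P i.+1)); [exact: Lends|exact: cell_nz].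
exists (mkseq L N); split.
- exact: fun_cycle.
- exists (cellof (P 1)); apply/(fun_cycle_cells N2 LN Linj); exists 0 => //; exact: Lends.
- move=> e /(fun_cycle_cells N2 LN Linj)[i iN ie]; exists (P i.+1); first exact: PS1.
  exact: ends_inj (Lends i iN) ie.
move=> B e Eo eB; apply/negP => /(fun_cycle_cells N2 LN Linj)[i iN ie].
have Ee := ends_inj (Lends i iN) ie.
(* One of the two lines of the cycle at [e] is [B], so a step on [B] has an end in [e]. The cut then
   forces its other end into [e], against [diffcell]. *)
case: (ends_cases ie eB) => EB.
  rewrite Lln // in EB.
  have [_ D] := Hln i iN; have De : detached o (ln i) e by rewrite Eo EB /detached.
  apply: (diffcell i iN); rewrite Ee; apply: (detached_inj (o := o) (L := ln i)) => //.
  by rewrite D Ee.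
have [_ D] := Hln _ (sN i); have De : detached o (ln (s i)) e by rewrite Eo EB /detached eqxx.
apply: (diffcell _ (sN i)); apply: (detached_inj (o := o) (L := ln (s i))); last rewrite -D.
  by rewrite Ps // Ee.
by rewrite Ps // Ee.
Qed.

Hypothesis pf : pseudoforest M.

(** The lines of a path without chords form a walk in the row-column graph whose edges are the cells
    of the points; backtracking would put two consecutive points in one cell and create a chord. As
    the walk starts and ends with the same cell of a cycle, it is periodic. *)
Lemma induced_path_winds (P : nat -> G) N w :
  (forall i, i < N -> edge (P i) (P i.+1)) ->
  (forall i j, i < j -> j < N -> ~~ edge (P i) (P j.+1)) ->
  1 < N -> is_gcycle M w -> cellof (P 0) \in cycle_cells w -> cellof (P N) = cellof (P 0) ->
  exists (A : nat -> V) (l : nat), [/\ 2 < l, l <= N,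
    forall a b, a < l -> b < l -> A a = A b -> a = b,
    A l = A 0 /\ (forall t, t + l <= N.+1 -> A (t + l) = A t) &
    (forall t, t <= N -> ends (A t) (A t.+1) (cellof (P t))) /\
    (forall i, i < N -> before (A i.+1) (P i) (P i.+1))].
Proof.
move=> PE chord N1 wc ew EN.
have /fun_choice[ln Hln] : forall i, exists L, i < N -> before L (P i) (P i.+1).
  move=> i; case: (ltnP i N) => [/PE/existsP[L H]|_]; first by exists L.
  by exists (inl (col (P 0))).
pose e := cellof (P 0).
(* [N] steps give only [N] lines for [N.+1] points. A line is added at each end, the other line of
   the first or last cell, so that every point becomes an edge of the walk. *)
pose A i := if i == 0 then opposite e (ln 0)
            else if i <= N then ln i.-1 else opposite e (ln N.-1).
have Aln i : i < N -> A i.+1 = ln i by rewrite /A /= => ->.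
have ABef i : i < N -> before (A i.+1) (P i) (P i.+1).
  by move=> iN; rewrite Aln //; exact: Hln.
have Aends t : t <= N -> ends (A t) (A t.+1) (cellof (P t)).
  case: t => [_|t tN].
    rewrite Aln; last by lia.
    rewrite endsC; apply: ends_opposite; have H : 0 < N by lia.
    by have /and3P[] := Hln 0 H.
  have [tN'|tN'] := ltnP t.+1 N.
    apply: incid_ends; first by have /and3P[] := ABef t tN.
      by have /and3P[] := ABef t.+1 tN'.
    move=> E; have := chord t t.+1 (ltnSn _) tN'.
    have H := ABef t tN; rewrite E in H.
    by rewrite (before_edge (before_trans H (ABef t.+1 tN'))).
  have Et : t.+1 = N by lia.
  rewrite (Aln t) // Et EN [A N.+1]/A /= ltnn -Et; apply: ends_opposite.
  by have /and3P[_ H _] := Hln t tN; move: H; rewrite /on Et EN.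
have Anb i : i < N -> A i <> A i.+2.
  move=> iN E; have Ec : cellof (P i) = cellof (P i.+1).
    have H1 := Aends i (ltnW iN); have H2 := Aends i.+1 iN.
    by rewrite E endsC in H1; exact: ends_inj H1 H2.
  have [i2|i2] := ltnP i.+1 N.
    have H := ABef i.+1 i2; have /negP := chord i i.+1 (ltnSn _) i2; apply.
    apply: (before_edge (before_trans _ H)); apply: (before_cell _ (ABef i iN)) => //.
    by case/and3P: H => H _ _; rewrite /on Ec.
  case: i iN Ec {E i2} (E, i2) => [|i] iN Ec [E i2]; first by lia.
  have iN' : i < N by lia.
  have H := ABef i iN'; have /negP := chord i i.+1 (ltnSn _) iN; apply.
  apply: (before_edge (before_trans H _)); apply: (before_cell _ (ABef i.+1 iN)) => //.
  by case/and3P: H.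
have Aadj i : i <= N -> rc_adj M (A i) (A i.+1).
  by move=> iN; apply/rc_adjP; exists (cellof (P i)); [exact: Aends|exact: cell_nz].
have [|l [l2 lN inj Ecc per]] :=
  walk_periodic pf Aadj Anb N1 wc ew (Aends 0 (leq0n _)).
  by rewrite -EN; exact: Aends.
by exists A, l; split=> //; split=> //; apply: (per 0); lia.
Qed.

End Gridded.

(** * Reduction to strongly connected components and to words *)

(** The list is sorted by decreasing number of reachable points; along an edge of an acyclic
    relation the reachable set shrinks strictly. *)
Lemma topological_sort (T : finType) (S : {set T}) (R : rel T) :
  (forall x y, R x y -> ~~ connect R y x) ->
  exists s : seq T, [/\ uniq s, s =i S &
    forall x y, x \in S -> y \in S -> R x y -> index x s < index y s].
Proof.
move=> acyc; pose rank x := #|[set y | connect R x y]|.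
pose leT := relpre rank geq.
have leT_tr : transitive leT by move=> b a c; rewrite /leT /= => ab bc; exact: leq_trans bc ab.
have ltot : total leT by move=> a b; exact: leq_total.
have lrefl : reflexive leT by move=> a; exact: leqnn.
exists (sort leT (enum S)).
have mS : sort leT (enum S) =i S by move=> x; rewrite mem_sort mem_enum.
split=> //; first by rewrite sort_uniq enum_uniq.
move=> x y xS yS Rxy; rewrite ltnNge; apply/negP => lyx.
have : leT y x.
  by apply: (sorted_leq_index leT_tr lrefl (sort_sorted ltot (enum S))) lyx; rewrite mS.
rewrite /leT /= leqNgt => /negP; apply; apply: proper_card; apply/properP; split.
  by apply/subsetP => z; rewrite !inE; exact: connect_trans (connect1 Rxy).
by exists x; rewrite !inE ?connect0 // acyc.
Qed.

Lemma path_connect_within (T : finType) (R : rel T) (B : {set T}) x y :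
  (forall z, connect R x z -> connect R z y -> z \in B) -> connect R x y ->
  connect [rel a b | [&& a \in B, b \in B & R a b]] x y.
Proof.
move=> HB /connectP[p]; elim: p x HB => [|z p IH] x HB /= => [_ ->|]; first exact: connect0.
case/andP=> Rxz pth Ey.
have czy : connect R z y by apply/connectP; exists p.
apply: connect_trans (IH z _ pth Ey); last first.
  by move=> t zt ty; apply: HB => //; exact: connect_trans (connect1 Rxz) zt.
have xB := HB x (connect0 _ _) (connect_trans (connect1 Rxz) czy).
by apply: connect1; rewrite /= xB (HB z (connect1 Rxz) czy).
Qed.

Section Labelled.
Variables (m n : nat) (M : 'M[int]_(m, n)) (A : Type) (leA : A -> A -> Prop).
Local Notation V := (rcvert m n).
Local Notation cell := ('I_m * 'I_n)%type.

Record lstr := LStr { gr : grd m n; supp : {set gr}; lab : gr -> A }.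

(** Keeping cells and edges makes the map strictly increasing on every line. The first alternative
    serves an empty carrier on the right, to which a nonempty one has no function. *)
Definition emb (X Y : lstr) : Prop :=
  supp X = set0 \/ exists f : gr X -> gr Y,
    (forall p, p \in supp X ->
       [/\ f p \in supp Y, cellof (f p) = cellof p & leA (lab p) (lab (f p))]) /\
    (forall p q, p \in supp X -> q \in supp X -> edge p q -> edge (f p) (f q)).

Hypothesis leA_trans : forall a b c, leA a b -> leA b c -> leA a c.

Lemma emb_trans X Y Z : emb X Y -> emb Y Z -> emb X Z.
Proof.
case=> [X0 _|[f [f1 f2]]]; first by left.
case=> [Y0|[g [g1 g2]]].
  left; apply/setP => p; rewrite inE; apply/negP => /f1[].
  by rewrite Y0 inE.
right; exists (g \o f); split=> [p pX|p q pX qX pq] /=.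
  have [fY Ef lf] := f1 p pX; have [gZ Eg lg] := g1 _ fY.
  by split=> //; [rewrite Eg|exact: leA_trans lg].
by apply: g2; [case: (f1 p pX)|case: (f1 q qX)|exact: f2].
Qed.

(** Reduces the preservation of an edge to excluding its reversal, which is how both uses of
    Higman's lemma conclude. *)
Lemma edge_reflected (X Y : lstr) (p q : gr X) (p' q' : gr Y) : wf (gr Y) M ->
  cellof p' = cellof p -> cellof q' = cellof q -> edge p q -> p' <> q' ->
  edge p' q' \/ edge q' p'.
Proof.
move=> W Ep Eq /existsP[L /and3P[pL qL _]] npq.
have pL' : on p' L by rewrite /on Ep.
have qL' : on q' L by rewrite /on Eq.
by case: (before_total W pL' qL' npq) => /before_edge; [left|right].
Qed.

(** * The sequence of strongly connected components *)

Section Components.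
Variables (G : grd m n) (S : {set G}).

Definition scc (x : G) : {set G} :=
  [set y | connect (sedge S None) x y && connect (sedge S None) y x].

Lemma scc_refl x : x \in scc x.
Proof. by rewrite inE connect0. Qed.

Lemma scc_eq x y : y \in scc x -> scc y = scc x.
Proof.
rewrite inE => /andP[xy yx]; apply/setP => z; rewrite !inE.
apply/andP/andP => -[c1 c2]; split.
- exact: connect_trans xy c1.
- exact: connect_trans c2 yx.
- exact: connect_trans yx c1.
- exact: connect_trans c2 xy.
Qed.

Lemma scc_sub x : x \in S -> scc x \subset S.
Proof.
move=> xS; apply/subsetP => y; rewrite inE => /andP[_] /connectP[[|z p]] /=.
  by move=> _ <-.
by case/andP=> /and3P[].
Qed.

Lemma scc_connected x y z : x \in S -> y \in scc x -> z \in scc x ->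
  connect (sedge (scc x) None) y z.
Proof.
move=> xS yx zx; have zy : z \in scc y by rewrite (scc_eq yx).
have cyz : connect (sedge S None) y z by move: zy; rewrite inE => /andP[].
have Hin t : connect (sedge S None) y t -> connect (sedge S None) t z -> t \in scc x.
  move=> yt tz; rewrite -(scc_eq yx) inE yt /=; apply: connect_trans tz _.
  by move: zy; rewrite inE => /andP[].
move: (path_connect_within Hin cyz); apply: connect_sub => a b /and3P[ax bx].
by rewrite sedge_None => /and3P[_ _ ab]; apply: connect1; rewrite sedge_None ax bx.
Qed.

Lemma scc_sequence : exists bs : seq {set G}, [/\ uniq bs,
  forall x, x \in S -> scc x \in bs,
  forall B, B \in bs -> exists2 x, x \in S & B = scc x &
  forall x y, x \in S -> y \in S -> edge x y -> index (scc x) bs <= index (scc y) bs].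
Proof.
pose Bl : {set {set G}} := [set scc x | x in S].
pose R (B C : {set G}) := [&& B \in Bl, C \in Bl, B != C &
   [exists x, [exists y, [&& x \in B, y \in C & sedge S None x y]]]].
have RE B C : connect R B C -> B \in Bl ->
    forall x y, x \in B -> y \in C -> connect (sedge S None) x y.
  case/connectP=> p; elim: p B => [|D p IH] B /=.
    move=> _ -> /imsetP[z zS ->] x y xz yz.
    have := yz; rewrite -(scc_eq xz) inE => /andP[] //.
  case/andP=> /and4P[BB DB _ /existsP[a /existsP[b /and3P[aB bD ab]]]] pth EC _ x y xB yC.
  apply: connect_trans (IH D pth EC DB b y bD yC); apply: connect_trans _ (connect1 ab).
  case/imsetP: BB xB aB => z zS -> xz.
  by rewrite -(scc_eq xz) inE => /andP[].
have [B C|bs [ubs mbs lt_bs]] := @topological_sort _ Bl R.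
  move=> RBC; apply/negP => CB.
  have /and4P[BB CB' nBC /existsP[a /existsP[b /and3P[aB bC ab]]]] := RBC.
  have ba := RE _ _ CB CB' b a bC aB.
  have /imsetP[x xS EB] := BB; have /imsetP[y yS EC] := CB'.
  case/eqP: nBC; rewrite EB EC in aB bC *; rewrite -(scc_eq aB) -(scc_eq bC).
  by apply/esym/scc_eq; rewrite inE ba connect1.
exists bs; split=> // [x xS|B|x y xS yS xy].
- by rewrite mbs imset_f.
- by rewrite mbs => /imsetP.
case: (eqVneq (scc x) (scc y)) => [->//|ne]; apply: ltnW; apply: lt_bs; rewrite ?imset_f //.
rewrite /R !imset_f // ne; apply/existsP; exists x; apply/existsP; exists y.
by rewrite !scc_refl sedge_None xS yS.
Qed.

End Components.

Definition block (X : lstr) (B : {set gr X}) := LStr B (@lab X).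

Lemma good_emb_components (P : lstr -> Prop) : good emb P ->
  good emb (fun X => wf (gr X) M /\ forall x, x \in supp X -> P (block (scc (supp X) x))).
Proof.
move=> gP X HX.
pose seqs (Y : lstr) (bs : seq {set gr Y}) := [/\ uniq bs,
  forall x, x \in supp Y -> scc (supp Y) x \in bs,
  forall B, B \in bs -> exists2 x, x \in supp Y & B = scc (supp Y) x &
  forall x y, x \in supp Y -> y \in supp Y -> edge x y ->
    index (scc (supp Y) x) bs <= index (scc (supp Y) y) bs].
have /fun_choice[w Hw] : forall k, exists w, exists2 bs, @seqs (X k) bs & w = map (@block (X k)) bs.
  by move=> k; have [bs H] := scc_sequence (supp (X k)); exists (map (@block (X k)) bs), bs.
have [k|i [j [ij sw]]] := @higman _ emb P emb_trans gP w.
  have [bs [_ _ Hbs _] ->] := Hw k; have [_ HP] := HX k.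
  elim: bs Hbs => [|B bs IH] Hbs /=; constructor.
    by have [x xS ->] := Hbs B (mem_head _ _); exact: HP.
  by apply: IH => C Cbs; apply: Hbs; rewrite inE Cbs orbT.
exists i, j; split=> //; have [WY _] := HX j.
move: sw; have [bs [ubs mbs bsP lbs] ->] := Hw i; have [bs' [ubs' _ bsP' lbs'] ->] := Hw j.
move: (X i) (X j) WY bs ubs mbs bsP lbs bs' ubs' bsP' lbs' =>
  {HX Hw w P gP} X0 Y W bs ubs mbs bsP lbs bs' ubs' bsP' lbs'.
case/subword_index => g; rewrite !size_map => -[g1 g2 g3].
  have [E0|[p0 p0X]] := set_0Vmem (supp X0); first by left.
  pose idx p := index (scc (supp X0) p) bs.
  have idxlt p : p \in supp X0 -> idx p < size bs by move=> pX; rewrite index_mem mbs.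
  have step k : k < size bs -> exists f : gr X0 -> gr Y,
     (forall p, p \in nth set0 bs k -> [/\ f p \in nth set0 bs' (g k),
         cellof (f p) = cellof p & leA (lab p) (lab (f p))]) /\
     (forall p q, p \in nth set0 bs k -> q \in nth set0 bs k -> edge p q -> edge (f p) (f q)).
    move=> ks; have := g3 (@block X0 set0) (@block Y set0) k ks.
    rewrite (nth_map (set0 : {set gr X0})) // (nth_map (set0 : {set gr Y})) ?g1 //.
    case=> /= [Bk|//].
    have [x xS Ex] := bsP _ (mem_nth set0 ks).
    by have := scc_refl (supp X0) x; rewrite -Ex Bk inE.
  have [f0 _] := step _ (idxlt _ p0X).
  have /fun_choice[F HF] : forall k, exists f : gr X0 -> gr Y, k < size bs ->
     (forall p, p \in nth set0 bs k -> [/\ f p \in nth set0 bs' (g k),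
         cellof (f p) = cellof p & leA (lab p) (lab (f p))]) /\
     (forall p q, p \in nth set0 bs k -> q \in nth set0 bs k -> edge p q -> edge (f p) (f q)).
    move=> k; case: (ltnP k (size bs)) => [/step[f Hf]|_]; first by exists f.
    by exists f0.
  have mem p : p \in supp X0 -> p \in nth set0 bs (idx p).
    by move=> pX; rewrite nth_index ?mbs // scc_refl.
  have sccY k y : k < size bs' -> y \in nth set0 bs' k ->
      y \in supp Y /\ index (scc (supp Y) y) bs' = k.
    move=> ks; have [x xS Ex] := bsP' _ (mem_nth set0 ks).
    rewrite Ex => yx; split; first by move/subsetP: (scc_sub xS); apply.
    by rewrite (scc_eq yx) -Ex index_uniq.
  right; exists (fun p => F (idx p) p); split=> [p pX|p q pX qX pq].
    have [/(_ p (mem p pX))[fp Ec lp] _] := HF _ (idxlt p pX).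
    by split=> //; have [] := sccY _ _ (g1 _ (idxlt p pX)) fp.
  have [H1 H2] := HF _ (idxlt p pX); have [H1' _] := HF _ (idxlt q qX).
  have [fp cp _] := H1 p (mem p pX); have [fq cq _] := H1' q (mem q qX).
  have := lbs p q pX qX pq; rewrite -/(idx p) -/(idx q) leq_eqVlt => /orP[/eqP E|lpq].
    rewrite -E; apply: H2 => //; first exact: mem.
    by rewrite E; exact: mem.
  have [fpY ip] := sccY _ _ (g1 _ (idxlt p pX)) fp.
  have [fqY iq] := sccY _ _ (g1 _ (idxlt q qX)) fq.
  have lg := g2 _ _ lpq (idxlt q qX).
  have nfpq : F (idx p) p <> F (idx q) q.
    by move=> E; move: ip; rewrite E iq => E'; rewrite E' ltnn in lg.
  (* Since [g] increases, the components of the images stand in the order of those of [p] and [q]; a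
     reversed edge would go back in the sequence of components of [Y]. *)
  case: (edge_reflected W cp cq pq nfpq) => // H.
  by have := lbs' _ _ fqY fpY H; rewrite ip iq leqNgt lg.
Qed.

Section Encoding.
Variables (Z Q : finType) (cellq : Q -> cell) (listed forced : Z -> Q -> Q -> bool).
Hypothesis listed_sym : forall z a b, listed z a b = listed z b a.
Hypothesis forced_asym : forall z a b, forced z a b -> ~~ forced z b a.

(* A word over [Q] determines a structure: an edge between two points whose
   letters are [listed] points forward in the word, and every other edge is
   dictated by the two letters. *)
Definition encodable (X : lstr) : Prop :=
  exists (z : Z) (s : seq (gr X)) (q : gr X -> Q), [/\ uniq s, s =i supp X,
    forall p, cellq (q p) = cellof p &
    forall p p', p \in supp X -> p' \in supp X -> edge p p' ->
      if listed z (q p) (q p') then index p s < index p' s else forced z (q p) (q p')].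

Lemma good_emb_encodable : good leA (fun _ => True) ->
  good emb (fun X => wf (gr X) M /\ encodable X).
Proof.
move=> gA X HX.
pose code (Y : lstr) z (s : seq (gr Y)) (q : gr Y -> Q) := [/\ uniq s, s =i supp Y,
    forall p, cellq (q p) = cellof p &
    forall p p', p \in supp Y -> p' \in supp Y -> edge p p' ->
      if listed z (q p) (q p') then index p s < index p' s else forced z (q p) (q p')].
(* The parameter [z] is repeated in every letter, so that matching words are read by the same
   rules. *)
have /fun_choice[w Hw] : forall k, exists w, exists z s q, @code (X k) z s q /\
    w = map (fun p => ((z, q p), lab p)) s.
  move=> k; have [_ [z [s [q H]]]] := HX k.
  by exists (map (fun p => ((z, q p), lab p)) s), z, s, q.
have tr (a b c : (Z * Q) * A) : a.1 = b.1 /\ leA a.2 b.2 -> b.1 = c.1 /\ leA b.2 c.2 ->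
    a.1 = c.1 /\ leA a.2 c.2.
  by move=> [-> ab] [-> bc]; split=> //; exact: leA_trans bc.
have [k|i [j [ij sw]]] := higman tr (good_fin_pair leA_trans gA) (x := w).
  by elim: (w k) => [|? ? ?]; constructor.
exists i, j; split=> //; have [WY _] := HX j.
move: sw; have [z [s [q [[us ms cq Hq] ->]]]] := Hw i.
have [z' [s' [q' [[us' ms' cq' Hq'] ->]]]] := Hw j.
move: (X i) (X j) WY s q us ms cq Hq s' q' us' ms' cq' Hq' =>
  {HX Hw w} X0 Y W s q us ms cq Hq s' q' us' ms' cq' Hq'.
case/subword_index => g; rewrite !size_map => -[g1 g2 g3].
have [E0|[p0 p0X]] := set_0Vmem (supp X0); first by left.
have p0s : index p0 s < size s by rewrite index_mem ms.
have [y0 _] : exists y0 : gr Y, True.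
  by case: s' {us' ms' Hq' g3} g1 => [/(_ _ p0s)//|y0 _ _]; exists y0.
pose f p := nth y0 s' (g (index p s)).
have fs p : p \in supp X0 -> index p s < size s by move=> pX; rewrite index_mem ms.
have F p : p \in supp X0 -> [/\ z = z', q p = q' (f p), leA (lab p) (lab (f p)),
    f p \in supp Y & index (f p) s' = g (index p s)].
  move=> pX; have ls := fs p pX; have gs := g1 _ ls.
  have := g3 ((z, q p), lab p) ((z, q p), lab p) _ ls.
  rewrite (nth_map p) // (nth_map y0) // nth_index ?ms //= -/(f p) => -[[-> ->] lp].
  by split=> //; rewrite ?index_uniq // -ms' mem_nth.
right; exists f; split=> [p pX|p p' pX pX' pp'].
  by have [_ Eq lp fY _] := F p pX; split=> //; rewrite -cq' -Eq cq.
have [Ez Eq _ fY Ei] := F p pX; have [_ Eq' _ fY' Ei'] := F p' pX'.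
have npp : index p s <> index p' s.
  move=> E; have Epp : p = p' by rewrite -(nth_index p (_ : p \in s)) ?ms // E nth_index ?ms.
  by move: pp'; rewrite Epp edge_irrefl.
have glt a b : a < b -> b < size s -> g a < g b by exact: g2.
have nf : f p <> f p'.
  move=> E; have := congr1 (index^~ s') E; rewrite Ei Ei'.
  case: (ltngtP (index p s) (index p' s)) => // l.
    by have := glt _ _ l (fs _ pX'); lia.
  by have := glt _ _ l (fs _ pX); lia.
have cp : cellof (f p) = cellof p by rewrite -cq' -Eq cq.
have cp' : cellof (f p') = cellof p' by rewrite -cq' -Eq' cq.
case: (edge_reflected W cp cp' pp' nf) => // ff.
(* Both pairs have the same letters, so one rule governs the edge and its supposed reversed image:
   the reversal contradicts either that [g] increases or that [forced] is asymmetric. *)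
have := Hq' _ _ fY' fY ff; have := Hq _ _ pX pX' pp'.
rewrite -Ez -Eq -Eq' listed_sym Ei Ei'; case: ifP => _ H.
  by have := glt _ _ H (fs _ pX'); lia.
by rewrite (negbTE (forced_asym H)).
Qed.

End Encoding.
End Labelled.

(** * Words for strongly connected components *)

Lemma connect_step (T : finType) (R : rel T) x y z t :
  connect R x y -> R y z -> connect R z t -> exists2 u, R x u & connect R u t.
Proof.
case/connectP=> -[_ -> Ryz zt|u p /= /andP[xu up] Ey Ryz zt]; first by exists z.
exists u => //; apply: connect_trans (connect_trans (connect1 Ryz) zt).
by apply/connectP; exists p.
Qed.

(* Acyclicity survives the gluing of the levels [h]: a detour into the highest
   level met by a closed walk can be shortcut. *)
Lemma acyclic_levels (T : finType) (R R0 up down : rel T) (h : T -> nat) :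
  (forall x y, R0 x y -> ~~ connect R0 y x) ->
  (forall x y, R x y -> [\/ R0 x y /\ h x = h y, up x y | down x y]) ->
  (forall x y, up x y -> h y = (h x).+1) ->
  (forall x y, down x y -> h x = (h y).+1) ->
  (forall x z z' x', up x z -> connect R0 z z' -> down z' x' -> h x = h x' -> R x x') ->
  forall x y, R x y -> ~~ connect R y x.
Proof.
move=> acyc Rcase hup hdown short.
(* Induction on a strict bound [t] for the levels that the closed walk may use. *)
pose Rt t : rel T := fun x y => [&& R x y, h x < t & h y < t].
suff H t x y : Rt t x y -> ~~ connect (Rt t) y x.
  move=> x y Rxy; pose t := (\max_z h z).+1.
  have ht z : h z < t by rewrite ltnS (leq_bigmax z).
  have := H t x y; rewrite {1}/Rt Rxy !ht => /(_ isT).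
  have -> // : connect (Rt t) y x = connect R y x.
  by apply: eq_connect => a b; rewrite /Rt !ht !andbT.
elim: t x y => [|t IH] x y; first by rewrite {1}/Rt !ltn0 !andbF.
move=> Rxy; apply/negP => cyx.
(* An excursion to level [t] goes up, runs along [R0] and comes down to the level just below, where
   [short] replaces it by one step. If the walk ends on level [t], the pending excursion is recorded
   instead. *)
have elim_top u v p : h u < t -> Rt t.+1 u v -> path (Rt t.+1) v p ->
    let z := last v p in
    (h z < t /\ exists2 v', Rt t u v' & connect (Rt t) v' z) \/
    (h z = t /\ exists a b, [/\ connect (Rt t) u a, up a b, (h a).+1 = t & connect R0 b z]).
  move=> ut uv; elim/last_ind: p => [_|p z IHp] /=.
    move: uv => /and3P[Ruv _]; rewrite ltnS leq_eqVlt => /orP[/eqP vt|vt].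
      right; split=> //; exists u, v; split; rewrite ?connect0 //.
        by case: (Rcase _ _ Ruv) => [[_]||/hdown]; [lia| |lia].
      case: (Rcase _ _ Ruv) => [[_]|/hup|/hdown]; lia.
    by left; split=> //; exists v; rewrite ?connect0 // /Rt Ruv ut vt.
  rewrite rcons_path last_rcons => /andP[/IHp {}IHp] /and3P[Ryz _].
  set y0 := last v p in IHp Ryz *; rewrite ltnS leq_eqVlt => /orP[/eqP zt|zt].
    right; split=> //; case: IHp => [[yt [v' uv' vy]]|[yt [a [b [ua ab at_ by_]]]]].
      exists y0, z; case: (Rcase _ _ Ryz) => [[_]|U|/hdown]; [lia| |lia].
      split=> //; last by have := hup _ _ U; lia.
      exact: connect_trans (connect1 uv') vy.
    exists a, b; split=> //; case: (Rcase _ _ Ryz) => [[U _]|/hup|/hdown]; [|lia|lia].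
    exact: connect_trans by_ (connect1 U).
  left; split=> //; case: IHp => [[yt [v' uv' vy]]|[yt [a [b [ua ab at_ by_]]]]].
    exists v' => //; apply: connect_trans vy (connect1 _); by rewrite /Rt Ryz yt zt.
  have D : down y0 z by case: (Rcase _ _ Ryz) => [[_]|/hup|//]; lia.
  have Raz : R a z by apply: (short _ _ _ _ ab by_ D); have := hdown _ _ D; lia.
  apply: (connect_step ua (y := a) (z := z)); last exact: connect0.
  by rewrite /Rt Raz zt -at_ ltnSn.
case: (classic (exists u, [/\ connect (Rt t.+1) y u, connect (Rt t.+1) u x & h u < t])).
  move=> [u [yu ux ut]].
  have [v uv vu] := connect_step ux Rxy yu.
  have [p pth Eu] := connectP vu.
  have := elim_top u v p ut uv pth; rewrite -Eu /= => -[[_ [v' uv' vu']]|[]]; last by lia.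
  by have := IH u v' uv'; rewrite vu'.
move=> top; have top' u : connect (Rt t.+1) y u -> connect (Rt t.+1) u x -> h u = t.
  move=> yu ux; have ut : ~~ (h u < t) by apply/negP => ut; apply: top; exists u.
  have : h u < t.+1; last by lia.
  by have [v /and3P[]] := connect_step ux Rxy yu.
(* The closed walk never leaves level [t], so all its steps belong to [R0]. *)
have hx : h x = t by apply: top'.
have hy : h y = t by apply: top'.
have Req a b : R a b -> h a = t -> h b = t -> R0 a b.
  by move=> /Rcase[[]//|/hup|/hdown]; lia.
have R0xy : R0 x y by apply: Req => //; case/and3P: Rxy.
have Hin u : connect (Rt t.+1) y u -> connect (Rt t.+1) u x -> u \in [set u | h u == t].
  by move=> yu ux; rewrite inE; apply/eqP/top'.
have /negP := acyc _ _ R0xy; apply.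
move: (path_connect_within Hin cyx); apply: connect_sub => a b /=.
rewrite !inE => /and3P[/eqP ha /eqP hb /and3P[ab _ _]]; exact/connect1/Req.
Qed.

Section StronglyConnected.
Variables (m n : nat) (M : 'M[int]_(m, n)) (K : nat).
Local Notation V := (rcvert m n).
Local Notation cell := ('I_m * 'I_n)%type.

(** Besides the cell, a letter holds the level, from 0 to [K] with [K.+1] for points out of reach,
    and two flags: being the last point of [e], and having an edge to it. *)
Definition letter : finType := (cell * 'I_K.+2 * bool * bool)%type.
Implicit Types a b : letter.

Definition lcell a : cell := a.1.1.1.
Definition level a : nat := a.1.1.2.
Definition is_top a : bool := a.1.2.
Definition below_top a : bool := a.2.

(** The pairs of cells whose edges along [B] are dropped when [e] is detached from [B]. *)
Definition crossing B (e : cell) (c c' : cell) :=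
  [&& incid c B, incid c' B & (c == e) != (c' == e)].

Definition listed (o : option (V * cell)) a b : bool :=
  if o is Some (B, e) then
    if is_top a || is_top b then false
    else if crossing B e (lcell a) (lcell b) then
      if lcell a == e then level a == (level b).+1 else level b == (level a).+1
    else level a == level b
  else true.

(** An edge that is not crossing never raises the level, an entry into [e] raises it by at most one,
    and an exit lowers it by at least one. The extreme cases are [listed]; the others are recognized
    by comparing levels. Exits from the last point of [e] may break this pattern, so its edges are
    read from the flags. *)
Definition forced (o : option (V * cell)) a b : bool :=
  if o is Some (B, e) then
    if is_top a then ~~ is_top b && ~~ below_top b
    else if is_top b then below_top a
    else if crossing B e (lcell a) (lcell b) then
      if lcell a == e then (level b).+1 < level a else level b <= level a
    else level b < level a
  else false.

Lemma crossingC B e c c' : crossing B e c c' = crossing B e c' c.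
Proof. by rewrite /crossing andbCA eq_sym. Qed.

Lemma listed_sym o a b : listed o a b = listed o b a.
Proof.
case: o => [[B e]|] //=; rewrite orbC crossingC; case: ifP => // _.
case: ifP => [/and3P[_ _]|_]; last by rewrite eq_sym.
by case: (lcell a == e); case: (lcell b == e).
Qed.

Lemma forced_asym o a b : forced o a b -> ~~ forced o b a.
Proof.
case: o => [[B e]|] //=; rewrite crossingC; case: (is_top a); case: (is_top b) => //=.
  by move=> ->.
case: ifP => [/and3P[_ _]|_]; last by lia.
by case: (lcell a == e); case: (lcell b == e) => // _; lia.
Qed.

(** The form in which bounded coil length is used; [perm_winding_bounded] derives it by showing that
    the points of such a path form a coil. *)
Definition winding_bounded (G : grd m n) : Prop :=
  forall (P : nat -> G) N w,
    (forall i, i < N -> edge (P i) (P i.+1)) ->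
    (forall i j, i < j -> j < N -> ~~ edge (P i) (P j.+1)) ->
    (forall i j, i < j -> j <= N -> P i <> P j) ->
    1 < N -> is_gcycle M w -> cellof (P 0) \in cycle_cells w ->
    cellof (P N) = cellof (P 0) -> N <= K.

Variables (G : grd m n) (S : {set G}).
Hypotheses (pf : pseudoforest M) (W : wf G M) (wb : winding_bounded G)
  (conn : forall p q, p \in S -> q \in S -> connect (sedge S None) p q).

Lemma last_in_cell e p0 : p0 \in S -> cellof p0 = e ->
  exists u, [/\ u \in S, cellof u = e &
    forall y, y \in S -> cellof y = e -> y = u \/ edge y u].
Proof.
move=> p0S p0e.
have P0 : (p0 \in S) && (cellof p0 == e) by rewrite p0S p0e eqxx.
case: (@Order.TotalTheory.arg_maxP _ _ _ p0
  (fun p => (p \in S) && (cellof p == e)) (@xkey _ _ G) P0).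
move=> u /andP[uS /eqP ue] umax; exists u; split=> // y yS ye.
case: (eqVneq y u) => [|/eqP nyu]; first by left.
right; have yL : on y (inl e.1) by rewrite /on ye /= eqxx.
have uL : on u (inl e.1) by rewrite /on ue /= eqxx.
case: (before_total W yL uL nyu) => [/before_edge//|/and3P[_ _]].
by rewrite ltNge => /negP[]; apply: umax; rewrite yS ye eqxx.
Qed.

Lemma first_in_cell e p0 : p0 \in S -> cellof p0 = e ->
  exists u, [/\ u \in S, cellof u = e &
    forall y, y \in S -> cellof y = e -> y = u \/ edge u y].
Proof.
move=> p0S p0e.
have P0 : (p0 \in S) && (cellof p0 == e) by rewrite p0S p0e eqxx.
case: (@Order.TotalTheory.arg_minP _ _ _ p0
  (fun p => (p \in S) && (cellof p == e)) (@xkey _ _ G) P0).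
move=> u /andP[uS /eqP ue] umin; exists u; split=> // y yS ye.
case: (eqVneq y u) => [|/eqP nyu]; first by left.
right; have yL : on y (inl e.1) by rewrite /on ye /= eqxx.
have uL : on u (inl e.1) by rewrite /on ue /= eqxx.
case: (before_total W yL uL nyu) => [/and3P[_ _]|/before_edge//].
by rewrite ltNge => /negP[]; apply: umin; rewrite yS ye eqxx.
Qed.

(** Places all cells of a strongly connected set in one component of the row-column graph, where
    there is at most one cycle. *)
Lemma connect_columns p q : connect (sedge S None) p q ->
  connect (rc_adj M) (inl (col p)) (inl (col q)).
Proof.
case/connectP=> s; elim: s p => [p _ ->//|r s IH p /= /andP[pr rs] Eq].
apply: connect_trans (IH r rs Eq).
have /existsP[[i|j] /and3P[]] := sedge_edge pr.
  by move=> /eqP /= -> /eqP /= -> _; exact: connect0.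
move=> /eqP /= Ep /eqP /= Er _.
apply: (@connect_trans _ _ (inr j)); apply: connect1 => /=.
  by rewrite -Ep; exact: cell_nz W p.
by rewrite -Er; exact: cell_nz W r.
Qed.

Lemma detached_Some (B L : V) (e c : cell) : detached (Some (B, e)) L c = (B == L) && (e == c).
Proof. by apply/eqP/andP => [[-> ->]|[/eqP-> /eqP->]]. Qed.

(* A shortest path from the last to the first point of a cycle cell winds around
   the cycle in one direction, so it always enters the cell through the same line. *)
Lemma descent e w u d : is_gcycle M w -> e \in cycle_cells w ->
  u \in S -> d \in S -> cellof u = e -> cellof d = e -> u = d \/ edge d u ->
  exists B N (P : nat -> G), [/\ incid e B, N <= K, P 0 = u, P N = d &
    forall i, i < N -> sedge S (Some (B, e)) (P i) (P i.+1) \/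
      [/\ P i \in S, P i.+1 \in S, before B (P i) (P i.+1), cellof (P i) <> e &
          cellof (P i.+1) = e]].
Proof.
move=> wc ew uS dS ue de ud.
have [N [P [P0 PN PR chord inj]]] := connect_induced_path (conn uS dS).
have PS i : i <= N -> P i \in S.
  case: i => [|i] iN; first by rewrite P0.
  by have /and3P[] := PR i iN.
have chordE i j : i < j -> j < N -> ~~ edge (P i) (P j.+1).
  move=> ij jN; have := chord i j ij jN; rewrite sedge_None !PS //; lia.
have PE i : i < N -> edge (P i) (P i.+1) by move=> /PR/sedge_edge.
case: N P0 PN PR chord inj PS chordE PE => [|[|N']] P0 PN PR chord inj PS chordE PE.
- exists (inl e.1), 0, P; split=> //; by rewrite /= eqxx.
- have := PE 0 isT; rewrite P0 PN => udE; case: ud => [E|du].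
    by rewrite E edge_irrefl in udE.
  by case: (edge_asym W udE du).
set N := N'.+2 in PN PR chord inj PS chordE PE *.
have e0 : cellof (P 0) \in cycle_cells w by rewrite P0 ue.
have EN : cellof (P N) = cellof (P 0) by rewrite P0 PN ue de.
have [A [l [l2 lN Ainj [Al Aper] [Aends Abef]]]] := induced_path_winds W pf PE chordE isT wc e0 EN.
have Amod s : s <= N.+1 -> A s = A (s %% l).
  elim/ltn_ind: s => s IHs sN; have [sl|ls] := ltnP s l; first by rewrite modn_small.
  rewrite -(subnK ls) modnDr Aper; last by lia.
  by apply: IHs; lia.
have Ae : ends (A 0) (A 1) e by rewrite -ue -P0; apply: Aends.
(* The first step runs along [A 1], so the path winds back into [e] through its other line [A 0]. *)
exists (A 0), N, P; split=> //.
- by have [] := ends_incid Ae.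
- exact: wb PE chordE inj isT wc e0 EN.
move=> i iN; have bi := Abef i iN; have iS := PS i (ltnW iN); have iS1 := PS i.+1 iN.
case: (boolP (detached (Some (A 0, e)) (A i.+1) (cellof (P i)) ==
              detached (Some (A 0, e)) (A i.+1) (cellof (P i.+1)))) => [/eqP Ed|nd].
  by left; apply/sedgeP; split=> //; exists (A i.+1).
right; have EA : A i.+1 = A 0.
  by move: nd; rewrite !detached_Some; case: (A 0 =P A i.+1).
have [ie|nie] := eqVneq (cellof (P i)) e; last first.
  split=> //; [by rewrite -EA|exact/eqP|].
  move: nd; rewrite !detached_Some EA eqxx /= [e == cellof (P i)]eq_sym (negbTE nie).
  by rewrite [e == _]eq_sym; case: (cellof _ =P e).
(* A step out of [e] along [A 0] would run around the cycle backwards: [i] would be 1 and [i.+1]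
   would be 0 modulo [l], although [l > 2]. *)
have Ai : A i = A 1.
  have := Aends i (ltnW iN); rewrite ie EA => H.
  have n01 := ends_neq Ae; by case: (ends_pair H Ae) => [[]|[]].
have l0 : 0 < l by exact: ltn_trans l2.
have il : i %% l = 1 %% l.
  apply: Ainj; rewrite ?ltn_mod // -!Amod //; exact: leqW (ltnW iN).
have i1l : i.+1 %% l = 0.
  by apply: Ainj; rewrite ?ltn_mod // -Amod // ltnW.
by move: i1l; rewrite -addn1 -modnDml il modnDml modn_small.
Qed.

(** A closed walk would yield a cycle of the row-column graph that avoids [e] but lies in the
    component of [w], whereas a pseudoforest gives both the same cells. *)
Lemma detached_acyclic e w B : is_gcycle M w -> e \in cycle_cells w ->
  (exists2 p, p \in S & cellof p = e) -> incid e B ->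
  forall x y, sedge S (Some (B, e)) x y -> ~~ connect (sedge S (Some (B, e))) y x.
Proof.
move=> wc ew [p pS pe] eB x y xy; apply/negP => yx.
have [w1 [w1c [e1 ew1] w1S /(_ B e erefl eB) /negP]] := closed_walk_gcycle W xy yx; apply.
have [q qS qe] := w1S _ ew1.
rewrite (pf w1c wc) //; exists (inl e1.1), (inl e.1).
split; first exact: cycle_cells_mem ew1.
split; first exact: cycle_cells_mem ew.
by rewrite -qe -pe; apply: connect_columns; exact: conn.
Qed.

Lemma cell_sedge o p q : p \in S -> q \in S -> cellof p = cellof q -> edge p q -> sedge S o p q.
Proof.
move=> pS qS E /existsP[L H]; apply/sedgeP; split=> //; exists L => //.
by rewrite E.
Qed.

(** * Levels in a component with a closed walk *)

Section Levels.
Variables (e : cell) (B : V) (u d : G) (N : nat) (P : nat -> G).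
Let o : option (V * cell) := Some (B, e).
Hypotheses (eB : incid e B) (uS : u \in S) (dS : d \in S) (ue : cellof u = e)
  (de : cellof d = e)
  (utop : forall y, y \in S -> cellof y = e -> y = u \/ edge y u)
  (dbot : forall y, y \in S -> cellof y = e -> y = d \/ edge d y)
  (acyc : forall x y, sedge S o x y -> ~~ connect (sedge S o) y x)
  (NK : N <= K) (P0 : P 0 = u) (PN : P N = d)
  (step : forall i, i < N -> sedge S o (P i) (P i.+1) \/
      [/\ P i \in S, P i.+1 \in S, before B (P i) (P i.+1), cellof (P i) <> e &
          cellof (P i.+1) = e]).

Definition enters x z :=
  [&& x \in S, z \in S, before B x z, cellof x != e & cellof z == e].

(* [reach t]: the points that can be reached from [u] by entering the cell [e]
   through the line [B] at most [t] times, and never leaving it through [B]. *)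
Fixpoint reach t : {set G} :=
  if t is t'.+1 then
    [set y | [exists z, connect (sedge S o) z y &&
       ((z \in reach t') || [exists x, (x \in reach t') && enters x z])]]
  else [set y | connect (sedge S o) u y].

Lemma reach_closed t x y : x \in reach t -> connect (sedge S o) x y -> y \in reach t.
Proof.
case: t => [|t]; rewrite !inE; first exact: connect_trans.
case/existsP=> z /andP[zx Hz] xy; apply/existsP; exists z; rewrite Hz andbT.
exact: connect_trans zx xy.
Qed.

Lemma reachS t x : x \in reach t -> x \in reach t.+1.
Proof. by move=> xt; rewrite inE; apply/existsP; exists x; rewrite connect0 xt. Qed.

Lemma reach_enter t x z : x \in reach t -> enters x z -> z \in reach t.+1.
Proof.
move=> xt xz; rewrite inE; apply/existsP; exists z; rewrite connect0 /=.
by apply/orP; right; apply/existsP; exists x; rewrite xt.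
Qed.

Lemma connect_in_cell z z' : z \in S -> z' \in S -> cellof z = cellof z' ->
  connect (sedge S o) z z' -> z = z' \/ sedge S o z z'.
Proof.
move=> zS zS' E c; case: (eqVneq z z') => [|/eqP nz]; first by left.
right; have zL : on z (inl (col z)) by rewrite /on /= eqxx.
have zL' : on z' (inl (col z)) by case: E => E _; rewrite /on /= E eqxx.
case: (before_total W zL zL' nz) => /before_edge H; first exact: cell_sedge.
by have := acyc (cell_sedge o zS' zS (esym E) H); rewrite c.
Qed.

(** Inside [e] the cut digraph only leads to later points, and these are also later on [B]. This
    supplies the shortcut that [acyclic_levels] asks for. *)
Lemma enters_connect x z z' : enters x z -> z' \in S -> cellof z' = e ->
  connect (sedge S o) z z' -> enters x z'.
Proof.
case/and5P=> xS zS xz xe /eqP ze z'S z'e c; rewrite /enters xS z'S xe z'e eqxx !andbT /=.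
case: (connect_in_cell zS z'S _ c) => [||/sedge_edge H]; [by rewrite ze|by move=> <-|].
apply: before_trans xz _; apply: (edge_on W) => //; by rewrite /on ?ze ?z'e.
Qed.

(** Without an entry no other point of [e] is reached, as [u] is the last one. Otherwise the final
    entry can be made directly to [z], by [enters_connect]. *)
Lemma reach_cell t z : z \in reach t -> z \in S -> cellof z = e ->
  z = u \/ exists t' x, [/\ t' < t, x \in reach t' & enters x z].
Proof.
elim: t => [|t IH] zt zS ze.
  left; rewrite inE in zt; case: (utop zS ze) => // zu.
  have E : cellof z = cellof u by rewrite ze ue.
  by have := acyc (cell_sedge o zS uS E zu); rewrite zt.
move: zt; rewrite inE => /existsP[g /andP[gz /orP[gt|/existsP[x /andP[xt xg]]]]].
  case: (IH (reach_closed gt gz) zS ze) => [|[t' [x [lt xt xz]]]]; first by left.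
  by right; exists t', x; split=> //; exact: ltnW.
by right; exists t, x; split=> //; exact: enters_connect gz.
Qed.

Definition height y := find (fun t => y \in reach t) (iota 0 K.+1).

Lemma height_lt y : height y < K.+2.
Proof. by rewrite ltnS -[X in _ <= X](size_iota 0 K.+1) find_size. Qed.

Lemma height_le t y : t <= K -> y \in reach t -> height y <= t.
Proof.
move=> tK yt; rewrite leqNgt; apply/negP => /(before_find 0).
by rewrite nth_iota // add0n yt.
Qed.

Lemma reach_height y : height y <= K -> y \in reach (height y).
Proof.
move=> yK; have := nth_find 0 (a := fun t => y \in reach t) (s := iota 0 K.+1).
rewrite has_find size_iota ltnS -/(height y) => /(_ yK).
by rewrite nth_iota // add0n.
Qed.

Lemma height_sedge x y : sedge S o x y -> height y <= height x.
Proof.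
move=> xy; have [xK|xK] := leqP (height x) K.
  by apply: height_le => //; apply: reach_closed (reach_height xK) (connect1 xy).
by have := height_lt y; lia.
Qed.

Lemma height_enters x z : enters x z -> height z <= (height x).+1.
Proof.
move=> xz; have [xK|xK] := ltnP (height x) K; last by have := height_lt z; lia.
by apply: height_le => //; apply: reach_enter (reach_height (ltnW xK)) xz.
Qed.

(** The path [P] enters [e] at most [N] times on its way to [d], and all other points of the cell
    follow [d]. So no point of [e] has the overflow level [K.+1]. *)
Lemma height_cell z : z \in S -> cellof z = e -> height z <= K.
Proof.
move=> zS ze; apply: leq_trans NK; apply: (height_le NK).
have PR i : i <= N -> P i \in reach i.
  elim: i => [|i IH] iN; first by rewrite P0 inE connect0.
  have {}IH := IH (ltnW iN); case: (step iN) => [/connect1|[iS iS1 bi ie ie1]].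
    by move/(reach_closed IH)/reachS.
  apply: reach_enter IH _; by rewrite /enters iS iS1 bi ie1 eqxx; case: eqP.
have := PR N (leqnn _); rewrite PN => dN.
case: (dbot zS ze) => [->//|dz]; apply: reach_closed dN (connect1 _).
by apply: cell_sedge => //; rewrite de ze.
Qed.

Definition leaves z x := [&& x \in S, z \in S, before B z x, cellof x != e & cellof z == e].

Lemma outside_sedge x x' : x \in S -> x' \in S -> cellof x != e -> cellof x' != e ->
  before B x x' -> sedge S o x x'.
Proof.
move=> xS xS' xe xe' H; apply/sedgeP; split=> //; exists B => //.
have D y : cellof y != e -> detached o B (cellof y) = false.
  by move=> ye; apply/negP => /eqP[E]; rewrite -E eqxx in ye.
by rewrite !D.
Qed.

(** [z] owes its level to an entry along [B] from some [x'] of smaller level. On [B], [x'] precedes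
    [z] and hence [x]; as neither [x'] nor [x] lies in [e], the edge between them survives the cut.
    The point [u] has level 0 without any entry, hence the exception. *)
Lemma height_leaves z x : leaves z x -> z != u -> height x < height z.
Proof.
case/and5P=> xS zS zx xe /eqP ze zu.
case: (reach_cell (reach_height (height_cell zS ze)) zS ze) => [E|[t [x' [tz xt xz]]]].
  by rewrite E eqxx in zu.
apply: (leq_ltn_trans _ tz); apply: height_le.
  exact: leq_trans (ltnW tz) (height_cell zS ze).
apply: reach_closed xt (connect1 _); have /and5P[xS' _ x'z xe' _] := xz.
by apply: outside_sedge => //; exact: before_trans x'z zx.
Qed.

Definition letter_of y : letter := (cellof y, inord (height y), y == u, edge y u).

Lemma level_of y : level (letter_of y) = height y.
Proof. by rewrite /level /= inordK // height_lt. Qed.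

Lemma edge_cases x y : x \in S -> y \in S -> edge x y ->
  if crossing B e (cellof x) (cellof y) then
    if cellof x == e then leaves x y else enters x y
  else sedge S o x y.
Proof.
move=> xS yS xy; case: ifP => [/and3P[xB yB]|ncr].
  have b : before B x y by apply: (edge_on W).
  rewrite /leaves /enters xS yS b /=.
  by case: (cellof x == e); case: (cellof y == e).
have /existsP[L H] := xy; apply/sedgeP; split=> //; exists L => //.
have [xL yL] : on x L /\ on y L by case/and3P: H.
rewrite !detached_Some; case: (eqVneq B L) => [E|//] /=.
subst L; move: ncr; rewrite /crossing -/(on x B) -/(on y B) xL yL /= => /negbFE/eqP.
by rewrite ![e == _]eq_sym.
Qed.

Lemma levels_code x y : x \in S -> y \in S -> edge x y ->
  listed o (letter_of x) (letter_of y) \/ forced o (letter_of x) (letter_of y).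
Proof.
move=> xS yS xy; rewrite /listed /forced /o !level_of /is_top /below_top /lcell /=.
case: (eqVneq x u) => [E|xu] /=.
  subst x; right; case: (eqVneq y u) => [E|yu] /=; first by rewrite E edge_irrefl in xy.
  by apply/negP => /(edge_asym W xy).
case: (eqVneq y u) => [E|yu] /=; first by subst y; right.
have := edge_cases xS yS xy; case: ifP => [cr|_].
  by case: ifP => xe; [move/height_leaves/(_ xu)|move/height_enters]; clear; lia.
by move/height_sedge; clear; lia.
Qed.

Lemma levels_encode (A : Type) (lab : G -> A) :
  encodable lcell listed forced (LStr S lab).
Proof.
pose R := [rel x y | [&& x \in S, y \in S, edge x y & listed o (letter_of x) (letter_of y)]].
have acycR x y : R x y -> ~~ connect R y x.
  pose up := [rel x y | enters x y && (height y == (height x).+1)].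
  pose down := [rel x y | leaves x y && (height x == (height y).+1)].
  apply: (@acyclic_levels _ R (sedge S o) up down height acyc).
  - move=> {x y} x y /and4P[xS yS xy].
    rewrite /listed /o !level_of /is_top /lcell /=; case: ifP => // _.
    have := edge_cases xS yS xy; case: ifP => [cr|_].
      by case: ifP => xe H E; [apply: Or33|apply: Or32]; rewrite /= H E.
    by move=> H /eqP E; apply: Or31.
  - by move=> {x y} x y /andP[_ /eqP].
  - by move=> {x y} x y /andP[_ /eqP].
  (* An excursion from [x] into [e] and back out along [B] puts [x] before [x'] on [B]. Both lie
     outside [e], so on equal levels this edge is listed. *)
  move=> {x y} x z z' x' /andP[xz _] zz' /andP[/and5P[x'S z'S z'x' x'e /eqP z'e] _] hx.
  have /and5P[xS _ xz' xe _] := enters_connect xz z'S z'e zz'.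
  have b := before_trans xz' z'x'.
  rewrite /= xS x'S (before_edge b) /listed /o !level_of /is_top /lcell /=.
  have neu t : cellof t != e -> (t == u) = false.
    by move=> te; apply/negP => /eqP E; rewrite E ue eqxx in te.
  by rewrite !neu //= /crossing (negbTE xe) (negbTE x'e) /= !andbF hx eqxx.
have [s [us ms Rs]] := topological_sort S acycR.
exists o, s, letter_of; split=> // x y xS yS xy; case: ifP => [l|nl].
  by apply: Rs => //; rewrite /= xS yS xy.
by case: (levels_code xS yS xy) => //; rewrite nl.
Qed.

End Levels.

Lemma strongly_connected_encodable (A : Type) (lab : G -> A) :
  encodable lcell listed forced (LStr S lab).
Proof.
case: (classic (exists x y, sedge S None x y /\ connect (sedge S None) y x)) =>
  [[x [y [xy yx]]]|acyc].
  have [w [wc [e ew] wS _]] := closed_walk_gcycle W xy yx.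
  have [p pS pe] := wS e ew.
  have [u [uS ue utop]] := last_in_cell pS pe.
  have [d [dS de dbot]] := first_in_cell pS pe.
  have ud : u = d \/ edge d u by case: (utop d dS de); [left|right].
  have [B [N [P [eB NK P0 PN st]]]] := descent wc ew uS dS ue de ud.
  have ac := detached_acyclic wc ew (ex_intro2 _ _ p pS pe) eB.
  exact: (@levels_encode e B u d N P).
have [x y|s [us ms Rs]] := @topological_sort G S (sedge S None).
  by move=> xy; apply/negP => yx; apply: acyc; exists x, y.
exists None, s, (fun p => (cellof p, ord0, false, false)); split=> // x y xS yS xy /=.
by apply: Rs => //; rewrite sedge_None xS yS.
Qed.

End StronglyConnected.

(** * Embeddings of labelled permutations *)

Lemma mask_positions (T : Type) (d : T) (y : seq T) (F : seq nat) :
  sorted ltn F -> all (gtn (size y)) F ->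
  mask [seq p \in F | p <- iota 0 (size y)] y = map (nth d y) F.
Proof.
move=> sF /allP aF; rewrite -[X in mask _ X](mkseq_nth d) /mkseq -map_mask -filter_mask.
congr map; apply: (irr_sorted_eq ltn_trans ltnn) => //.
  by apply: sorted_filter; [exact: ltn_trans|exact: iota_ltn_sorted].
move=> p; rewrite mem_filter mem_iota /= add0n.
by case: (boolP (p \in F)) => // /aF.
Qed.

Lemma Forall2_nthP (A B : Type) (R : A -> B -> Prop) (d : A) (d' : B) s t : size s = size t ->
  List.Forall2 R s t <-> forall i, i < size s -> R (nth d s i) (nth d' t i).
Proof.
elim: s t => [|a s IH] [|b t] //=.
move=> [/IH {}IH]; split=> [F|H]; first by inversion F; subst => -[|i] //= lis; apply: (IH.1 _ i).
by constructor; [exact: (H 0)|apply: IH.2 => i; exact: (H i.+1)].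
Qed.

Definition point (L : Type) (x : seq (nat * L)) (i : 'I_(size x)) := tnth (in_tuple x) i.

Lemma point_nth (L : Type) (x : seq (nat * L)) d i : point (x := x) i = nth d x i.
Proof. exact: tnth_nth. Qed.

Lemma point_value (L : Type) (x : seq (nat * L)) (i : 'I_(size x)) :
  nth 0 (map fst x) i = (point i).1.
Proof. by rewrite (nth_map (point i)) // -point_nth. Qed.

Lemma lcontainedP (L : Type) (leL : L -> L -> Prop) (x y : seq (nat * L)) :
  lcontained leL x y <-> exists f : 'I_(size x) -> 'I_(size y),
    [/\ forall i j : 'I_(size x), i < j -> f i < f j,
        forall i j, ((point i).1 < (point j).1) = ((point (f i)).1 < (point (f j)).1) &
        forall i, leL (point i).2 (point (f i)).2].
Proof.
have [x0|xn] := posnP (size x).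
  have nox : 'I_(size x) -> False by case=> i; rewrite x0.
  split=> [_|_]; first by exists (fun i => False_rect _ (nox i)); split=> i; case: (nox i).
  exists [::]; rewrite (size0nil x0) mask0s.
  by split; [split|constructor].
split=> [[msk [[Es Ho] HF]]|[f [f1 f2 f3]]].
  rewrite !size_map in Es Ho.
  have [d _] : exists d : nat * L, True.
    by case: {Es Ho HF} x xn => // d _ _; exists d.
  pose idx := mask msk (iota 0 (size y)).
  have Em : mask msk y = map (nth d y) idx.
    by rewrite map_mask -{1}(mkseq_nth d y).
  rewrite Em size_map in Es Ho HF.
  have idxy i : i < size x -> nth 0 idx i < size y.
    move=> ix; have : nth 0 idx i \in idx by rewrite mem_nth // -Es.
    by move/mem_mask; rewrite mem_iota.
  have sidx : sorted ltn idx.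
    by apply: (subseq_sorted ltn_trans (mask_subseq _ _)); exact: iota_ltn_sorted.
  pose f (i : 'I_(size x)) := Ordinal (idxy i (ltn_ord i)).
  have pf i : point (f i) = nth d (map (nth d y) idx) i.
    by rewrite (point_nth d) (nth_map 0) // -Es.
  exists f; split=> [i j ij|i j|i].
  - by rewrite /f /=; apply: (sorted_ltn_nth ltn_trans 0 sidx); rewrite ?inE -?Es.
  - have := Ho i j (ltn_ord i) (ltn_ord j); rewrite -!point_value => ->.
    by rewrite !(point_value, pf) !(nth_map d) ?size_map -?Es.
  - have Es' : size x = size (map (nth d y) idx) by rewrite size_map.
    by have /(Forall2_nthP _ d d Es') := HF; rewrite pf (point_nth d); apply.
pose F := [seq val (f i) | i <- enum 'I_(size x)].
have [d _] : exists d : nat * L, True by exists (point (Ordinal xn)).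
have sF : size F = size x by rewrite size_map size_enum_ord.
have nF (i : 'I_(size x)) : nth 0 F i = f i.
  by rewrite (nth_map i) ?size_enum_ord // nth_ord_enum.
have soF : sorted ltn F.
  apply/(sortedP 0) => i; rewrite sF => ix.
  have ix' : i < size x by exact: ltnW.
  by rewrite (nF (Ordinal ix')) (nF (Ordinal ix)); apply: f1.
exists [seq p \in F | p <- iota 0 (size y)]; rewrite (mask_positions d) //; last first.
  by apply/allP => p /mapP[i _ ->] /=.
have E i : nth d (map (nth d y) F) (nat_of_ord i) = point (f i).
  by rewrite (nth_map 0) ?sF // nF -point_nth.
split; last first.
  apply/(Forall2_nthP _ d d); first by rewrite size_map sF.
  by move=> i ix; rewrite (E (Ordinal ix)) -(point_nth d (Ordinal ix)); exact: f3.
split; first by rewrite (size_map fst x) (size_map fst _) (size_map _ F) sF.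
move=> i j; rewrite size_map => ix jx.
rewrite (point_value (Ordinal ix)) (point_value (Ordinal jx)) f2 -!E.
have szF : size [seq nth d y p | p <- F] = size x by rewrite (size_map _ F).
by rewrite !(nth_map d) ?szF.
Qed.

(** * Gridded permutations and their subpermutations *)

Lemma incol_exists k (v : nat -> nat) L p : v 0 = 0 -> v k = L -> p < L ->
  exists i : 'I_k, incol v i p.
Proof.
move=> v0 vk pL.
have [|j [pj jmin]] := @ex_least (fun j => p < v j); first by exists k; rewrite vk.
case: j pj jmin => [|j] pj jmin; first by rewrite v0 in pj.
have jk : j < k.
  rewrite ltnNge; apply/negP => kj; apply: (jmin k); [by rewrite ltnS|by rewrite vk].
exists (Ordinal jk); rewrite /incol pj andbT leqNgt; apply/negP.
exact: jmin.
Qed.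

Section Lines.
Variables (k : nat) (v : nat -> nat).
Hypothesis vmono : forall i, i < k -> v i <= v i.+1.

Lemma line_mono i j : i <= j -> j <= k -> v i <= v j.
Proof.
move=> ij jk; elim: j ij jk => [|j IH]; first by rewrite leqn0 => /eqP->.
rewrite leq_eqVlt => /orP[/eqP->//|ij] jk.
by apply: leq_trans (IH ij (ltnW jk)) (vmono jk).
Qed.

Lemma incol_ltn (i j : 'I_k) p q : incol v i p -> incol v j q -> i < j -> p < q.
Proof.
case/andP=> _ pi /andP[jq _] ij; apply: leq_trans pi (leq_trans _ jq).
exact: line_mono (ltnW (ltn_ord j)).
Qed.

Lemma incol_inj (i j : 'I_k) p : incol v i p -> incol v j p -> i = j.
Proof.
move=> ip jp; apply: val_inj; case: (ltngtP i j) => // ij.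
  by have := incol_ltn ip jp ij; rewrite ltnn.
by have := incol_ltn jp ip ij; rewrite ltnn.
Qed.

End Lines.

Lemma sign_cases (z : int) : z \in [:: 1%R; (-1)%R] -> z = 1%R \/ z = (-1)%R.
Proof. by rewrite !inE => /orP[] /eqP; [left|right]. Qed.

Lemma eq1N1 : ((1 : int) == -1)%R = false. Proof. by []. Qed.
Lemma eqN11 : ((-1 : int) == 1)%R = false. Proof. by []. Qed.

Lemma ltz_sign (z : int) (a b : nat) : z \in [:: 1%R; (-1)%R] ->
  (z * a%:Z < z * b%:Z)%R = if z == 1%R then a < b else b < a.
Proof.
by case/sign_cases=> ->; rewrite ?mul1r ?mulN1r ?ltrN2 ?ltz_nat.
Qed.

Lemma eqz_sign (z : int) (a b : nat) : z \in [:: 1%R; (-1)%R] ->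
  (z * a%:Z = z * b%:Z)%R -> a = b.
Proof.
by case/sign_cases=> ->; rewrite ?mul1r ?mulN1r; [case|move/oppr_inj; case].
Qed.

Section PermutationGrid.
Variables (m n : nat) (M : 'M[int]_(m, n)) (c : 'I_m -> int) (r : 'I_n -> int).
Local Notation V := (rcvert m n).
Local Notation cell := ('I_m * 'I_n)%type.

(* The keys are positions and values, reversed in the lines oriented backwards. *)
Definition perm_grd (s : seq nat) N (cl : 'I_N -> 'I_m) (rw : 'I_N -> 'I_n) : grd m n :=
  @Grd m n 'I_N cl rw (fun p => c (cl p) * (p : nat)%:Z)%R
    (fun p => r (rw p) * (nth 0%N s p)%:Z)%R.

Variables (s : seq nat) (v h : nat -> nat).

(** [N] is kept apart from [size s] because [s] will be [map fst x] with the points indexed by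
    ['I_(size x)]. *)
Record compatible N (cl : 'I_N -> 'I_m) (rw : 'I_N -> 'I_n) : Prop := Compatible {
  comp_size : size s = N;
  comp_col : forall p, incol v (cl p) p;
  comp_row : forall p, inrow h (rw p) (nth 0 s p) }.

Hypotheses (pm : pmm_with M c r) (sp : is_perm s)
  (gr : is_gridding M s v h).

Lemma is_perm_uniq : uniq s.
Proof. by rewrite (perm_uniq sp) iota_uniq. Qed.

Lemma perm_ltn p : p < size s -> nth 0 s p < size s.
Proof. by move=> ps; have := mem_nth 0 ps; rewrite (perm_mem sp) mem_iota. Qed.

Lemma gridding_cols i : i < m -> v i <= v i.+1.
Proof. by case: gr => _ [_ []] + _; apply. Qed.

Lemma gridding_rows j : j < n -> h j <= h j.+1.
Proof. by case: gr => _ [_ [_ [_ [_ []]]]] + _; apply. Qed.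

Lemma compatible_exists N : size s = N ->
  exists (cl : 'I_N -> 'I_m) (rw : 'I_N -> 'I_n), compatible cl rw.
Proof.
move=> sN; have [v0 [vm [_ [h0 [hn _]]]]] := gr.
have [cl Hcl] : exists cl : 'I_N -> 'I_m, forall p, incol v (cl p) p.
  apply: (@fin_all_exists 'I_N (fun _ => 'I_m) (fun p i => incol v i p)) => p.
  by apply: incol_exists v0 vm _; rewrite sN.
have [rw Hrw] : exists rw : 'I_N -> 'I_n, forall p : 'I_N, inrow h (rw p) (nth 0 s p).
  apply: (@fin_all_exists 'I_N (fun _ => 'I_n) (fun p j => inrow h j (nth 0 s p))) => p.
  by apply: (@incol_exists n h (size s)) => //; apply: perm_ltn; rewrite sN.
by exists cl, rw.
Qed.

Variables (N : nat) (cl : 'I_N -> 'I_m) (rw : 'I_N -> 'I_n).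
Hypothesis cmp : compatible cl rw.
Local Notation G := (perm_grd s cl rw).

(** As nonzero entries are [c i * r j], reversing the lines of sign -1 makes every cell increasing;
    this is [key_agree]. *)
Lemma perm_wf : wf G M.
Proof.
have [sN Hc Hr] := cmp; have [cs rs Mcr] := pm.
have rowE (p : 'I_N) : p < size s by rewrite sN.
split=> [[i|j] p q /eqP pL /eqP qL E|p q [Ec Er]|p].
- apply: val_inj; apply: (@eqz_sign (c i)) => //.
  by move: E; rewrite /= in pL qL *; rewrite pL qL.
- have : nth 0 s p = nth 0 s q.
    apply: (@eqz_sign (r j)) => //.
    by move: E; rewrite /= in pL qL *; rewrite pL qL.
  by move/eqP; rewrite nth_uniq ?is_perm_uniq // => /eqP/val_inj.
- rewrite /= in Ec Er *; rewrite -Ec -Er !ltz_sign //.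
  have [_ [_ [_ [_ [_ [_ H]]]]]] := gr; have {H}[nz H] := H (cl p) (rw p).
  have inp : in_cell v h s (cl p) (rw p) p by rewrite /in_cell Hc Hr.
  have inq : in_cell v h s (cl p) (rw p) q by rewrite /in_cell Ec Er Hc Hr.
  have Mp := Mcr _ _ (nz _ (rowE p) inp).
  have mon a b : a < b -> b < N -> in_cell v h s (cl p) (rw p) a ->
      in_cell v h s (cl p) (rw p) b ->
      if c (cl p) == r (rw p) then nth 0 s a < nth 0 s b else nth 0 s b < nth 0 s a.
    rewrite -sN => ab bs ina inb; have := H a b ab bs ina inb; rewrite Mp.
    by case: (sign_cases (cs (cl p))) => ->; case: (sign_cases (rs (rw p))) => -> /andP[].
  case: (ltngtP p q) => [pq|qp|/val_inj->]; last by rewrite !ltnn; do 2!case: ifP.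
    have := mon p q pq (ltn_ord q) inp inq.
    by case: (sign_cases (cs (cl p))) => ->; case: (sign_cases (rs (rw p))) => ->;
      rewrite ?eqxx ?eq1N1 ?eqN11; lia.
  have := mon q p qp (ltn_ord p) inq inp.
  by case: (sign_cases (cs (cl p))) => ->; case: (sign_cases (rs (rw p))) => ->;
      rewrite ?eqxx ?eq1N1 ?eqN11; lia.
have [_ [_ [_ [_ [_ [_ H]]]]]] := gr; have [nz _] := H (cl p) (rw p).
by apply: (nz p (rowE p)); rewrite /in_cell Hc Hr.
Qed.

Lemma oedgeE (p q : G) : oedge c r v h s p q = edge p q.
Proof.
have [sN Hc Hr] := cmp; have [cs rs _] := pm.
apply/orP/existsP =>
  [[/existsP[i /and3P[pi qi pq]]|/existsP[j /and3P[pj qj pq]]]|[[i|j] /and3P[pL qL pq]]].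
- exists (inl i).
  have Ep : cl p = i by apply: incol_inj gridding_cols _ _ _ (Hc p) pi.
  have Eq : cl q = i by apply: incol_inj gridding_cols _ _ _ (Hc q) qi.
  by rewrite /before /on /= Ep Eq eqxx /= ltz_sign.
- exists (inr j).
  have Ep : rw p = j by apply: incol_inj gridding_rows _ _ _ (Hr p) pj.
  have Eq : rw q = j by apply: incol_inj gridding_rows _ _ _ (Hr q) qj.
  by rewrite /before /on /= Ep Eq eqxx /= ltz_sign.
- left; apply/existsP; exists i; move: pL qL pq; rewrite /on /= => /eqP Ep /eqP Eq.
  by rewrite -{1}Ep -{1}Eq !Hc Ep Eq ltz_sign.
right; apply/existsP; exists j; move: pL qL pq; rewrite /on /= => /eqP Ep /eqP Eq.
by rewrite -{1}Ep -{1}Eq !Hr Ep Eq ltz_sign.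
Qed.

Lemma in_cellE (i : 'I_m) (j : 'I_n) (p : G) : in_cell v h s i j p = (cellof p == (i, j)).
Proof.
have [sN Hc Hr] := cmp; apply/andP/eqP => [[pi pj]|[<- <-]] //.
congr pair; first exact: incol_inj gridding_cols _ _ _ (Hc p) pi.
exact: incol_inj gridding_rows _ _ _ (Hr p) pj.
Qed.

End PermutationGrid.

(** * Restriction of a gridded permutation to chosen points *)

Section Subpermutation.
Variables (m n : nat) (M : 'M[int]_(m, n)) (c : 'I_m -> int) (r : 'I_n -> int).
Variables (s : seq nat) (v h : nat -> nat) (F : seq nat).
Hypotheses (sp : is_perm s) (gr : is_gridding M s v h) (soF : sorted ltn F)
  (aF : all (gtn (size s)) F).

(** The rank of [y] in [t]: it standardizes the chosen values and also moves a grid line to the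
    number of chosen points before it. *)
Definition below (t : seq nat) y := count (fun z => z < y) t.

Lemma below_mono t x y : x <= y -> below t x <= below t y.
Proof. by move=> xy; apply: sub_count => z /= zx; exact: leq_trans zx xy. Qed.

Lemma below_leq t x y : y \in t -> (below t x <= below t y) = (x <= y).
Proof.
move=> yt; apply/idP/idP => [|xy]; last exact: below_mono.
apply: contraTT; rewrite -!ltnNge => yx.
rewrite /below -[X in _ <= X]/(count _ _) (_ : count (fun z => z < x) t =
  count (fun z => z < y) t + count (fun z => y <= z < x) t).
  by rewrite -addn1 leq_add2l -has_count; apply/hasP; exists y; rewrite ?leqnn.
rewrite -count_predUI [X in _ + X](_ : _ = 0) ?addn0.
  by apply: eq_count => z /=; lia.
by rewrite -(count_pred0 t); apply: eq_count => z /=; lia.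
Qed.

Lemma below_ltn t x y : x \in t -> (below t x < below t y) = (x < y).
Proof. by move=> xt; rewrite !ltnNge below_leq. Qed.

Lemma below_all t y : all (gtn y) t -> below t y = size t.
Proof. by move=> ?; apply/eqP; rewrite -all_count. Qed.

Lemma below_sorted t p : sorted ltn t -> p < size t -> below t (nth 0 t p) = p.
Proof.
move=> st pt; rewrite /below -[X in count _ X](mkseq_nth 0) count_map.
rewrite (eq_in_count (a2 := fun i => i < p)); last first.
  move=> i; rewrite mem_iota /= => it; apply/idP/idP => [|ip].
    rewrite !ltnNge; apply: contra => pi; move: pi; rewrite leq_eqVlt => /orP[/eqP->//|pi].
    by apply: ltnW; apply: (sorted_ltn_nth ltn_trans 0 st).
  by apply: (sorted_ltn_nth ltn_trans 0 st).
rewrite -(subnKC (ltnW pt)) iotaD count_cat.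
rewrite (eq_in_count (a2 := predT)) => [|i]; last by rewrite mem_iota.
rewrite count_predT size_iota (eq_in_count (a2 := pred0)) => [|i].
  by rewrite count_pred0 addn0.
by rewrite mem_iota /=; lia.
Qed.

Definition picked := map (nth 0 s) F.
Definition subperm := map (below picked) picked.
Definition subcols k := below F (v k).
Definition subrows k := below picked (h k).

Lemma size_subperm : size subperm = size F.
Proof. by rewrite !size_map. Qed.

Lemma F_lt p : p < size F -> nth 0 F p < size s.
Proof. by move=> pF; move/allP: aF => /(_ _ (mem_nth 0 pF)). Qed.

Lemma nth_picked p : p < size F -> nth 0 picked p = nth 0 s (nth 0 F p).
Proof. by move=> pF; rewrite (nth_map 0). Qed.

Lemma nth_subperm p : p < size F ->
  nth 0 subperm p = below picked (nth 0 s (nth 0 F p)).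
Proof. by move=> pF; rewrite (nth_map 0) ?size_map // nth_picked. Qed.

Lemma mem_picked p : p < size F -> nth 0 s (nth 0 F p) \in picked.
Proof. by move=> pF; rewrite -nth_picked // mem_nth // size_map. Qed.

Lemma subperm_ltn p q : p < size F -> q < size F ->
  (nth 0 subperm p < nth 0 subperm q) = (nth 0 s (nth 0 F p) < nth 0 s (nth 0 F q)).
Proof. by move=> pF qF; rewrite !nth_subperm // below_ltn // mem_picked. Qed.

Lemma F_ltn p q : p < size F -> q < size F -> (nth 0 F p < nth 0 F q) = (p < q).
Proof.
by move=> pF qF; rewrite -(below_ltn (t := F)) ?mem_nth // !below_sorted.
Qed.

Lemma uniq_F : uniq F.
Proof. exact: (sorted_uniq ltn_trans ltnn soF). Qed.

Lemma is_perm_subperm : is_perm subperm.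
Proof.
have up : uniq picked.
  rewrite map_inj_in_uniq ?uniq_F // => a b /(allP aF) /= aS /(allP aF) /= bS /eqP.
  by rewrite nth_uniq // ?(is_perm_uniq sp) // => /eqP.
have us : uniq subperm.
  rewrite map_inj_in_uniq // => a b ap bp E; apply/eqP; rewrite eqn_leq.
  by rewrite -(below_leq _ bp) -(below_leq _ ap) E !leqnn.
rewrite /is_perm; apply: uniq_perm => //; first exact: iota_uniq.
have [] := @uniq_min_size _ subperm (iota 0 (size subperm)) us; rewrite ?size_iota //.
move=> y /mapP[z zp ->]; rewrite mem_iota add0n /= size_map.
rewrite /below -(count_predC (fun x => x < z) picked) -[X in X < _]addn0 ltn_add2l -has_count.
by apply/hasP; exists z => //=; rewrite ltnn.
Qed.

Lemma subperm_contained : contained subperm s.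
Proof.
exists [seq p \in F | p <- iota 0 (size s)]; rewrite (mask_positions 0) //.
split; first by rewrite !size_map.
move=> i j; rewrite size_subperm => iF jF.
by rewrite subperm_ltn // -!nth_picked.
Qed.

Lemma incol_sub i p : p < size F -> incol subcols i p = incol v i (nth 0 F p).
Proof.
move=> pF; rewrite /incol /subcols ltnNge -{1 2}(below_sorted soF pF).
by rewrite !below_leq ?mem_nth // -ltnNge.
Qed.

Lemma inrow_sub j p : p < size F ->
  inrow subrows j (nth 0 subperm p) = inrow h j (nth 0 s (nth 0 F p)).
Proof.
move=> pF; rewrite /inrow /subrows nth_subperm // ltnNge.
by rewrite !below_leq ?mem_picked // -ltnNge.
Qed.

Lemma in_cell_sub i j p : p < size F ->
  in_cell subcols subrows subperm i j p = in_cell v h s i j (nth 0 F p).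
Proof. by move=> pF; rewrite /in_cell incol_sub // inrow_sub. Qed.

Lemma oedge_sub p q : p < size F -> q < size F ->
  oedge c r subcols subrows subperm p q = oedge c r v h s (nth 0 F p) (nth 0 F q).
Proof.
move=> pF qF; rewrite /oedge; congr orb; apply: eq_existsb => i.
  by rewrite !incol_sub // !F_ltn.
by rewrite !inrow_sub // !subperm_ltn.
Qed.

Lemma subperm_gridding : is_gridding M subperm subcols subrows.
Proof.
have [v0 [vm [vmo [h0 [hn [hmo H]]]]]] := gr.
have b0 t : below t 0 = 0 by elim: t => //= a t ->.
split; first by rewrite /subcols v0 b0.
split; first by rewrite /subcols vm below_all // size_subperm.
split; first by move=> k km; apply: below_mono; exact: vmo.
split; first by rewrite /subrows h0 b0.
split.
  rewrite /subrows hn below_all ?size_map //; apply/allP => y /mapP[p /(allP aF) /= ps ->].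
  by have := mem_nth 0 ps; rewrite (perm_mem sp) mem_iota.
split; first by move=> k kn; apply: below_mono; exact: hmo.
move=> i j; rewrite size_subperm; have [H1 H2] := H i j; split=> [p pF|p q pq qF].
  by rewrite in_cell_sub // => /H1; apply; exact: F_lt.
have pF := ltn_trans pq qF; rewrite !in_cell_sub // !subperm_ltn //.
by apply: H2; [rewrite F_ltn|exact: F_lt].
Qed.

End Subpermutation.

(** * Coils *)

Section Coils.
Variables (m n : nat) (M : 'M[int]_(m, n)) (c : 'I_m -> int) (r : 'I_n -> int).
Variables (s : seq nat) (v h : nat -> nat).
Hypotheses (pm : pmm_with M c r) (sp : is_perm s)
  (gr : is_gridding M s v h).
Variables (N : nat) (cl : 'I_N -> 'I_m) (rw : 'I_N -> 'I_n).
Hypothesis cmp : compatible s v h cl rw.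
Local Notation G := (perm_grd c r s cl rw).

(** The restriction of [s] to the points of the path stays in [C] and is a coil. The path gives the
    forward edges; a backward edge joins two points of a common line, where the absence of chords
    rules out the opposite direction. *)
Lemma perm_winding_bounded (C : seq nat -> Prop) k : pseudoforest M -> perm_class C -> C s ->
  (forall t, C t -> is_coil M c r t -> size t <= k) -> winding_bounded M k G.
Proof.
move=> pf [_ Ccl] Cs bnd P T w PE chord inj T1 wc ew ET.
have W : wf G M := perm_wf pm sp gr cmp.
have [A [l [l2 lT Ainj [Al Aper] [Aends Abef]]]] :=
  induced_path_winds W pf PE chord T1 wc ew ET.
have l0 : 0 < l by exact: ltn_trans l2.
have Ladj i : i < l -> rc_adj M (A i) (A i.+1).
  move=> il; apply/rc_adjP; exists (cellof (P i)); last exact: cell_nz W _.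
  exact: Aends (leq_trans (ltnW il) lT).
have AendsL i : i < l -> ends (A i) (A i.+1) (cellof (P i)).
  by move=> il; apply: Aends; exact: leq_trans (ltnW il) lT.
have Pinj i j : i <= T -> j <= T -> P i = P j -> i = j.
  move=> iT jT E; case: (ltngtP i j) => // ij; first by case: (inj i j ij jT).
  by case: (inj j i ij iT).
have cellper t : t + l <= T -> cellof (P (t + l)) = cellof (P t).
  move=> tT; have H1 := Aends _ tT; have H2 := Aends t (leq_trans (leq_addr _ _) tT).
  rewrite Aper 1?ltnW // -addSn Aper // in H1; exact: ends_inj H1 H2.
have cellmod t : t <= T -> cellof (P (t %% l)) = cellof (P t).
  elim/ltn_ind: t => t IH tT; have [tl|lt] := ltnP t l; first by rewrite modn_small.
  have tl : t - l < t by rewrite ltn_subrL l0 (leq_trans l0 lt).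
  rewrite -{1}(subnK lt) modnDr IH //; last exact: leq_trans (leq_subr _ _) tT.
  by rewrite -cellper subnK.
pose pos t : nat := (P t : 'I_N).
have poss t : pos t < size s by rewrite (comp_size cmp) /pos ltn_ord.
(* The positions of the path in increasing order, as [subperm] requires; [o] below recovers the
   order along the path. *)
pose F := [seq p <- iota 0 (size s) | p \in mkseq pos T.+1].
have soF : sorted ltn F by apply: sorted_filter; [exact: ltn_trans|exact: iota_ltn_sorted].
have aF : all (gtn (size s)) F.
  by apply/allP => p; rewrite mem_filter mem_iota => /and3P[].
have memF p : (p \in F) = (p \in mkseq pos T.+1).
  rewrite mem_filter andb_idr // => /mapP[t _ ->]; by rewrite mem_iota poss.
have posF t : t <= T -> pos t \in F.
  by move=> tT; rewrite memF map_f // mem_iota.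
have umk : uniq (mkseq pos T.+1).
  rewrite map_inj_in_uniq ?iota_uniq // => i j; rewrite !mem_iota /= => iT jT /val_inj.
  exact: Pinj.
have szF : size F = T.+1.
  rewrite -(size_mkseq pos T.+1); apply: perm_size; apply: uniq_perm => //.
  exact: uniq_F soF.
pose o := mkseq (fun t => index (pos t) F) T.+1.
have ont t : t <= T -> nth 0 o t = index (pos t) F by move=> tT; rewrite nth_mkseq.
have olt t : t <= T -> nth 0 o t < size F by move=> tT; rewrite ont // index_mem posF.
have Fo t : t <= T -> nth 0 F (nth 0 o t) = pos t.
  by move=> tT; rewrite ont // nth_index // posF.
have oe i j : i <= T -> j <= T ->
    oedge c r (subcols v F) (subrows s h F) (subperm s F) (nth 0 o i) (nth 0 o j) =
    edge (P i) (P j).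
  move=> iT jT; rewrite oedge_sub ?olt // !Fo //.
  exact: (oedgeE pm gr cmp).
have po : perm_eq o (iota 0 T.+1).
  have uo : uniq o.
    rewrite map_inj_in_uniq ?iota_uniq // => i j; rewrite !mem_iota /= => iT jT E.
    apply: Pinj => //; apply: val_inj.
    by have := congr1 (nth 0 F) E; rewrite !nth_index ?posF.
  apply: uniq_perm => //; first exact: iota_uniq.
  have [] := @uniq_min_size _ o (iota 0 T.+1) uo; rewrite ?size_iota ?size_mkseq //.
  move=> y /mapP[t]; rewrite !mem_iota /= => tT ->; rewrite add0n -szF index_mem.
  exact: posF.
have sC : C (subperm s F).
  by apply: Ccl Cs _ _; [exact: is_perm_subperm|exact: subperm_contained].
have : size (subperm s F) <= k; last by rewrite size_subperm szF; exact: ltnW.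
apply: bnd => //; split; first exact: is_perm_subperm.
exists (subcols v F), (subrows s h F); split; first exact: subperm_gridding.
have Esz : size (subperm s F) = T.+1 by rewrite size_subperm.
exists o, (mkseq A l), (fun t => cellof (P t)); rewrite Esz size_mkseq; cbv zeta.
split; first exact: fun_cycle.
split; first by [].
split; first exact: po.
split.
  by move=> t tl; apply/(fun_cycle_cells l2 Al Ainj); exists t => //; exact: AendsL.
split.
  move=> e /(fun_cycle_cells l2 Al Ainj)[i il ie]; exists i => //.
  exact: ends_inj (AendsL i il) ie.
split.
  move=> t u tl ul E; apply: (ends_fun_inj l2 Al Ainj tl ul (AendsL t tl)).
  by rewrite E; exact: AendsL.
split.
  move=> t; rewrite ltnS => tT; rewrite in_cell_sub ?olt // Fo //.
  by rewrite (in_cellE gr cmp); have [E1 E2] := cellmod t tT; apply/eqP; rewrite /cellof /= E1 E2.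
split.
  move=> [//|t] /andP[_ tT]; rewrite oe //; [exact: PE|exact: ltnW].
split; last first.
  rewrite oe //; have H0 := Aends 0 (leq0n _).
  have onl : on (P l) (A 0) by have /ends_incid[H _] := Aends l lT; rewrite -Al.
  have on0 : on (P 0) (A 0) by have /ends_incid[H _] := Aends 0 (leq0n _).
  have ne : P l <> P 0 by move=> /(Pinj _ _ lT (leq0n _)) E; rewrite E in l2.
  case: (before_total W onl on0 ne) => /before_edge // H.
  have l1 : 0 < l.-1 by rewrite -ltnS prednK // ltnW.
  by have := chord 0 l.-1 l1; rewrite prednK // H => /(_ lT).
move=> t /andP[lt tT]; rewrite ltnS in tT.
have tlT : t - l.+1 <= T := leq_trans (leq_subr _ _) tT.
rewrite oe //.
have t1 : (t - l.+1).+1 + l = t by rewrite addSnnS subnK.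
have onl : on (P t) (A t) by have /ends_incid[] := Aends t tT.
(* The point lies on [A (t - l)], which is [A t] by periodicity. *)
have on0 : on (P (t - l.+1)) (A t).
  have /ends_incid[_] := Aends (t - l.+1) tlT.
  by rewrite -[in A t]t1 Aper // t1; exact: leqW.
have lt' : t - l.+1 < t.-1 by lia.
have ne : P t <> P (t - l.+1).
  by move=> /(Pinj _ _ tT tlT) E; move: lt'; rewrite -E; lia.
case: (before_total W onl on0 ne) => /before_edge // H.
have tp : t.-1.+1 = t by rewrite prednK //; exact: leq_ltn_trans lt.
have := chord (t - l.+1) t.-1 lt'; rewrite tp => /(_ tT); by rewrite H.
Qed.

End Coils.

(** * Edges into the next cell of a coil *)

Section CoilOrder.
Variables (m n : nat) (M : 'M[int]_(m, n)) (G : grd m n).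
Hypothesis W : wf G M.
Variables (Q : nat -> G) (N l : nat) (lab : nat -> 'I_m * 'I_n).
Hypotheses (lN : l < N) (l1 : 1 < l)
  (Qlab : forall t, t < N -> cellof (Q t) = lab (t %% l))
  (Qnext : forall t, t.+1 < N -> edge (Q t) (Q t.+1))
  (Qback : forall t, l.+1 <= t -> t < N -> edge (Q t) (Q (t - l.+1)))
  (Qfirst : edge (Q l) (Q 0)).

(** For one period, go from index [b.+1 + l] back to [b] and forward to [b.+1]: the two outer points
    share a cell, so all three lie on the line of the forward edge. [Qfirst] covers index 0, which
    has no predecessor. *)
Lemma coil_period a q : a + q.+1 * l < N -> edge (Q (a + q.+1 * l)) (Q a).
Proof.
have Ecell b j : b + j * l < N -> cellof (Q (b + j * l)) = cellof (Q b).
  move=> bN; have bN0 : b < N by apply: leq_ltn_trans bN; rewrite leq_addr.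
  by rewrite !Qlab // addnC modnMDl.
have tr : forall b j i, b + (i + j) * l < N -> edge (Q (b + (i + j) * l)) (Q (b + j * l)) ->
    edge (Q (b + j * l)) (Q b) -> edge (Q (b + (i + j) * l)) (Q b).
  move=> b j i bN e1 e2; have bN' : b + j * l < N.
    by apply: leq_ltn_trans bN; rewrite leq_add2l leq_mul2r leq_addl orbT.
  pose L : rcvert m n := inl (col (Q b)).
  have onb : on (Q b) L by rewrite /on /= eqxx.
  have on1 : on (Q (b + j * l)) L by rewrite /on Ecell.
  have on2 : on (Q (b + (i + j) * l)) L by rewrite /on Ecell.
  exact: before_edge (before_trans (edge_on W on2 on1 e1) (edge_on W on1 onb e2)).
have one b : b + l < N -> edge (Q (b + l)) (Q b).
  case: b => [|b] bN; first by rewrite add0n.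
  have e1 : edge (Q (b.+1 + l)) (Q b).
    have := Qback (t := b.+1 + l); rewrite addSnnS addnK => H; apply: H => //.
      exact: leq_addl.
    by rewrite -addSnnS.
  have bN' : b.+1 < N by apply: leq_ltn_trans bN; rewrite leq_addr.
  have e2 := Qnext bN'; have /existsP[L Lb] := e1; have /existsP[L' Lb'] := e2.
  have Ec : cellof (Q (b.+1 + l)) = cellof (Q b.+1).
    by have := @Ecell b.+1 1; rewrite mul1n; apply.
  have [/and3P[o1 o2 _] /and3P[o3 o4 _]] := (Lb, Lb').
  have o1' : on (Q (b.+1 + l)) L' by rewrite /on Ec.
  exact: before_edge (before_trans (edge_on W o1' o3 e1) Lb').
elim: q => [|q IH] aN; first by rewrite mul1n in aN *; exact: one.
have aN' : a + q.+1 * l < N.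
  by apply: leq_ltn_trans aN; rewrite leq_add2l leq_mul2r leqnSn orbT.
apply: (tr a q.+1 1) => //; last exact: IH.
rewrite add1n mulSn addnCA addnC; apply: one.
by rewrite addnC addnCA -mulSn.
Qed.

(** If [b] exceeded [a.+1], a backward edge would lead from [Q b] to [Q a] or to a point whole
    periods after it, from which [coil_period] leads to [Q a]; this reverses the given edge. *)
Lemma coil_edge_le a b : a < N -> b < N -> b %% l = a.+1 %% l -> edge (Q a) (Q b) -> b <= a.+1.
Proof.
move=> aN bN Eb ab; rewrite leqNgt; apply/negP => lab_.
have l0 : 0 < l by exact: ltnW.
have [q Eq] : exists q, b = a.+1 + q.+1 * l.
  have /dvdnP[q Eq] : l %| b - a.+1 by rewrite -eqn_mod_dvd ?Eb // ltnW.
  case: q Eq => [|q] Eq; first by move: lab_; rewrite -subn_gt0 Eq.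
  by exists q; rewrite -Eq subnKC // ltnW.
have back : edge (Q b) (Q (a + q * l)).
  have Eb' : b - l.+1 = a + q * l by rewrite Eq mulSn; lia.
  by rewrite -Eb'; apply: Qback => //; rewrite Eq mulSn; lia.
case: q Eq back => [|q] Eq back.
  by rewrite mul0n addn0 in back; exact: (edge_asym W ab back).
have qN : a + q.+1 * l < N.
  apply: leq_ltn_trans bN; rewrite Eq addSn; apply: leqW.
  by rewrite leq_add2l leq_mul2r leqnSn orbT.
have per := coil_period qN.
have /existsP[L /and3P[ob oq H]] := back.
have Ec : cellof (Q (a + q.+1 * l)) = cellof (Q a).
  by rewrite !Qlab // addnC modnMDl.
have oa : on (Q a) L by rewrite /on -Ec.
apply: (edge_asym W ab (before_edge (before_trans _ (edge_on W oq oa per)))).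
by rewrite /before ob oq.
Qed.

End CoilOrder.

(** * The two directions *)

Section Main.
Variables (m n : nat) (M : 'M[int]_(m, n)) (c : 'I_m -> int) (r : 'I_n -> int).
Hypothesis pm : pmm_with M c r.
Local Notation cell := ('I_m * 'I_n)%type.

(** The two numbers are the length of the cycle and the residue of the index; [m * n] bounds both,
    because a cycle has distinct cells. *)
Definition coil_label : finType := ('I_(m * n).+1 * 'I_(m * n).+1 * cell * bool * bool)%type.
Definition label_at (l : nat) (lab : nat -> cell) (N t : nat) : coil_label :=
  (inord l, inord (t %% l), lab (t %% l), t == 0, t.+1 == N).

Definition labelled_coil (x : seq (nat * coil_label)) : Prop :=
  exists (cl : 'I_(size x) -> 'I_m) (rw : 'I_(size x) -> 'I_n) l (lab : nat -> cell)
    (Q : nat -> perm_grd c r (map fst x) cl rw),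
  [/\ wf (perm_grd c r (map fst x) cl rw) M,
      [/\ l < size x, 1 < l & l <= m * n],
      (forall p, exists2 t, t < size x & Q t = p),
      (forall t, t < size x -> cellof (Q t) = lab (t %% l) /\
        (point (x := x) (Q t)).2 = label_at l lab (size x) t) &
      [/\ forall t, t.+1 < size x -> edge (Q t) (Q t.+1),
          forall t, l.+1 <= t -> t < size x -> edge (Q t) (Q (t - l.+1)) &
          edge (Q l) (Q 0)]].

Lemma coil_labelled s : is_coil M c r s ->
  exists x, map fst x = s /\ labelled_coil x.
Proof.
case=> sp [v [h [gr [o [w [lab]]]]]]; cbv zeta.
case=> [wc [lN [po [labcc [_ [labI [C1 [C2 [C3 C4]]]]]]]]].
set l := size w in lN labcc labI C1 C2 C3 C4; set N := size s in lN po C1 C2 C3 C4.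
pose x := mkseq (fun p => (nth 0 s p, label_at l lab N (index p o))) N.
have Ex : map fst x = s by rewrite /x /mkseq -map_comp -[RHS](mkseq_nth 0).
have sx : size x = N by rewrite size_mkseq.
exists x; split=> //; rewrite /labelled_coil Ex.
have [cl [rw cmp]] := compatible_exists sp gr (esym sx : size s = size x).
have oN t : t < N -> nth 0 o t < N.
  move=> tN; have : nth 0 o t \in iota 0 N.
    by rewrite -(perm_mem po) mem_nth // (perm_size po) size_iota.
  by rewrite mem_iota.
have uo : uniq o by rewrite (perm_uniq po) iota_uniq.
have so : size o = N by rewrite (perm_size po) size_iota.
have [Q HQ] : exists Q : nat -> 'I_(size x), forall t, t < N -> Q t = nth 0 o t :> nat.
  apply: (@fun_choice nat 'I_(size x) (fun t q => t < N -> q = nth 0 o t :> nat)) => t.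
  have [tN|_] := ltnP t N.
    by have H : nth 0 o t < size x by [rewrite sx oN]; exists (Ordinal H).
  have H : 0 < size x by rewrite sx (leq_ltn_trans _ lN).
  by exists (Ordinal H).
have l2 : 2 < l by case/and3P: wc.
have oeE t u : t < N -> u < N -> oedge c r v h s (nth 0 o t) (nth 0 o u) ->
    edge (Q t : perm_grd c r s cl rw) (Q u).
  by move=> tN uN; rewrite -!HQ // (oedgeE pm gr cmp).
rewrite -sx in lN po C1 C2 C3 oN so HQ oeE.
exists cl, rw, l, lab, Q; split.
- exact: (perm_wf pm sp gr cmp).
- split=> //; first exact: ltnW.
  have inj : injective (fun t : 'I_l => lab t).
    by move=> t u /(labI _ _ (ltn_ord t) (ltn_ord u))/val_inj.
  by have := leq_card _ inj; rewrite card_prod !card_ord.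
- move=> p; have pN := ltn_ord (p : 'I_(size x)).
  have po' : nat_of_ord (p : 'I_(size x)) \in o by rewrite (perm_mem po) mem_iota.
  have ix : index (nat_of_ord (p : 'I_(size x))) o < size x by rewrite -[X in _ < X]so index_mem.
  exists (index (nat_of_ord (p : 'I_(size x))) o) => //.
  by apply: val_inj; rewrite /= HQ ?nth_index.
- move=> t tN; split.
    have := C1 t tN; rewrite -HQ //.
    rewrite (in_cellE gr cmp _ _ (Q t : perm_grd c r s cl rw)) => /eqP ->.
    by case: (lab _).
  rewrite (point_nth (0, label_at l lab N 0)) HQ // nth_mkseq -?sx ?oN //=.
  by rewrite index_uniq ?so // sx.
split=> [t tN|t lt tN|]; apply: oeE => //.
- exact: ltnW.
- by have := C2 t.+1; rewrite ltn0Sn tN => /(_ isT).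
- by apply: leq_ltn_trans tN; rewrite leq_subr.
- by apply: C3; rewrite lt tN.
- exact: leq_ltn_trans lN.
Qed.

Lemma label_at_inj l lab N t l' lab' N' t' : 0 < l -> 0 < l' -> l <= m * n -> l' <= m * n ->
  label_at l lab N t = label_at l' lab' N' t' ->
  [/\ l = l', t %% l = t' %% l', lab (t %% l) = lab' (t' %% l'), (t == 0) = (t' == 0) &
      (t.+1 == N) = (t'.+1 == N')].
Proof.
move=> l0 l0' lm lm' [E1 E2 E3 -> ->].
have := congr1 val E1; have := congr1 val E2; rewrite /= !inordK //;
  by apply: leq_trans (ltn_pmod _ _) _ => //; exact: leqW.
Qed.

(* An embedding maps the [t]-th point to a point of index at most [t], since an edge
   into the next cell of a coil advances the index by at most one. *)
Lemma labelled_coil_not_embedded x y : labelled_coil x -> labelled_coil y ->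
  size x < size y -> ~ lcontained eq x y.
Proof.
move=> [cl [rw [l [lab [Q [W [lN l1 lm] Qs Ql [Qn _ _]]]]]]].
move=> [cl' [rw' [l' [lab' [Q' [W' [lN' l1' lm'] Qs' Ql' [Qn' Qb' Qf']]]]]]] xy.
case/lcontainedP=> f [f1 f2 f3].
pose G := perm_grd c r (map fst x) cl rw; pose G' := perm_grd c r (map fst y) cl' rw'.
have l0 := ltnW l1; have l0' := ltnW l1'.
have img t : t < size x -> exists t', [/\ t' < size y, f (Q t) = Q' t' &
    [/\ l = l', t %% l = t' %% l', lab (t %% l) = lab' (t' %% l'), (t == 0) = (t' == 0) &
      (t.+1 == size x) = (t'.+1 == size y)]].
  move=> tx; have [t' ty Et] := Qs' (f (Q t)); exists t'; split=> //.
  have := f3 (Q t); have [_ ->] := Ql t tx; rewrite -Et; have [_ ->] := Ql' t' ty.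
  exact: label_at_inj.
(* The labels carry the cells, so an embedding of the bare permutations respects the griddings and
   thereby preserves edges. *)
have fcell (p : G) : cellof (f p : G') = cellof p.
  have [t tx <-] := Qs p; have [t' [ty -> [_ _ Elab _ _]]] := img t tx.
  by have [-> _] := Ql t tx; have [-> _] := Ql' t' ty.
have fm (p q : 'I_(size x)) : (f p < f q) = (p < q).
  case: (ltngtP p q) => [/f1//|/f1 H|/val_inj->]; last by rewrite ltnn.
  by apply/negbTE; rewrite -leqNgt ltnW.
have fedge (p q : G) : edge p q -> edge (f p : G') (f q).
  have [cs rs _] := pm.
  case/existsP=> -[i|j] /and3P[pL qL pq]; apply/existsP; [exists (inl i)|exists (inr j)];
    rewrite /before /on !fcell; apply/and3P; split=> //;
    move: pL qL (fcell p) (fcell q) pq => /eqP /= pL /eqP /= qL [Ep Ep'] [Eq Eq'].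
    by rewrite Ep Eq pL qL !ltz_sign // !fm.
  rewrite Ep' Eq' pL qL !ltz_sign // !point_value.
  by rewrite !f2.
have key t : t < size x -> exists t', 
    [/\ t' < size y, f (Q t) = Q' t', t' <= t, l = l' /\ t %% l = t' %% l &
      (t.+1 == size x) = (t'.+1 == size y)].
  elim: t => [|t IH] tx; have [t' [ty Et [El Em _ E0 EN]]] := img _ tx.
    by exists t'; split=> //; [move: E0; rewrite eqxx => /esym/eqP->|rewrite Em El].
  exists t'; split=> //; last by rewrite Em El.
  have [u [uy Eu ut [_ Emu] _]] := IH (ltnW tx).
  have e := fedge _ _ (Qn t tx); rewrite Eu Et in e.
  have Emod : t' %% l' = u.+1 %% l'.
    by rewrite -Em -El -addn1 -modnDml Emu modnDml addn1.
  have Ql'' t0 : t0 < size y -> cellof (Q' t0) = lab' (t0 %% l') by case/Ql'.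
  by have := coil_edge_le W' lN' l1' Ql'' Qn' Qb' Qf' uy ty Emod e; move/leq_trans; apply.
have x0 : 0 < size x by exact: leq_ltn_trans lN.
have xl : (size x).-1 < size x by rewrite prednK.
have [t' [ty _ tt _]] := key _ xl; rewrite prednK // eqxx => /esym/eqP Et.
by move: tt; rewrite -ltnS prednK // Et leqNgt xy.
Qed.

Lemma lwqo_coils_bounded (C : seq nat -> Prop) : lwqo C ->
  exists k, forall s, C s -> is_coil M c r s -> size s <= k.
Proof.
move=> wqoC; apply: NNPP => unb.
have /fun_choice[g Hg] : forall k, exists x : seq (nat * coil_label),
    [/\ C (map fst x), labelled_coil x & k < size x].
  move=> k; apply: NNPP => nk; apply: unb; exists k => s Cs /coil_labelled[x [Ex lx]].
  rewrite leqNgt; apply/negP => ks; apply: nk; exists x; split=> //; first by rewrite Ex.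
  by rewrite -(size_map fst) Ex.
(* Each coil is longer than its predecessor, so a comparable pair would go from a shorter coil to a
   longer one. *)
pose xs := fix xs k := if k is k'.+1 then g (size (xs k')) else g 0.
have Hxs k : C (map fst (xs k)) /\ labelled_coil (xs k).
  by case: k => [|k]; [case: (Hg 0)|case: (Hg (size (xs k)))].
have wqoL : wqo_on (fun _ => True) (@eq coil_label).
  split; first by split=> // a b d _ _ _ -> ->.
  exact: good_fin.
have [_ /(_ xs (fun k => (Hxs k).1))[i [j [ij]]]] := wqoC _ _ wqoL.
apply: (labelled_coil_not_embedded (Hxs i).2 (Hxs j).2).
apply: (incr_ltn (g := fun k => size (xs k))) ij => k.
by case: (Hg (size (xs k))).
Qed.

Lemma lcontained_qo (L : Type) (leL : L -> L -> Prop) (P : seq (nat * L) -> Prop) :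
  qo_on (fun _ => True) leL -> qo_on P (lcontained leL).
Proof.
case=> refl trans; split=> [x _|x y z _ _ _].
  by apply/lcontainedP; exists id; split=> // i; exact: refl.
move=> /lcontainedP[f [f1 f2 f3]] /lcontainedP[g [g1 g2 g3]].
apply/lcontainedP; exists (g \o f); split=> [i j ij|i j|i] /=.
- by apply: g1; apply: f1.
- by rewrite f2 g2.
- exact: trans (f3 i) (g3 (f i)).
Qed.

(** Two points of one row are ordered by an edge, two points of different rows by the rows, which
    the map keeps; likewise for columns. *)
Lemma emb_lcontained (L : Type) (leL : L -> L -> Prop) (x y : seq (nat * L)) v h v' h'
    (cl : 'I_(size x) -> 'I_m) (rw : 'I_(size x) -> 'I_n)
    (cl' : 'I_(size y) -> 'I_m) (rw' : 'I_(size y) -> 'I_n) :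
  is_perm (map fst x) -> is_perm (map fst y) ->
  is_gridding M (map fst x) v h -> is_gridding M (map fst y) v' h' ->
  compatible (map fst x) v h cl rw -> compatible (map fst y) v' h' cl' rw' ->
  emb leL (@LStr _ _ _ (perm_grd c r (map fst x) cl rw) setT (fun i => (point (x := x) i).2))
          (@LStr _ _ _ (perm_grd c r (map fst y) cl' rw') setT (fun i => (point (x := y) i).2)) ->
  lcontained leL x y.
Proof.
move=> px py gx gy cx cy; have [cs rs _] := pm.
have Wy : wf _ M := perm_wf pm py gy cy.
case=> [/= E|[f [f1 f2]]]; apply/lcontainedP.
  have nox (p : 'I_(size x)) : False.
    by have := in_setT (p : perm_grd c r (map fst x) cl rw); rewrite E inE.
  by exists (fun p => False_rect _ (nox p)); split=> i; case: (nox i).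
pose G := perm_grd c r (map fst x) cl rw; pose G' := perm_grd c r (map fst y) cl' rw'.
have cellf (p : G) : cellof (f p : G') = cellof p by case: (f1 p (in_setT _)).
have fL (p q : G) ln : before ln p q -> before ln (f p : G') (f q).
  move=> H; have /and3P[pL qL _] := H; apply: (edge_on Wy); rewrite /on ?cellf //.
  by apply: f2; rewrite ?in_setT //; exact: before_edge H.
have fv (p q : 'I_(size x)) : (point p).1 < (point q).1 ->
    (point (f p : 'I_(size y))).1 < (point (f q : 'I_(size y))).1.
  have [Er|ne] := eqVneq (rw p) (rw q).
    rewrite -!point_value => pq.
    have H a b : rw a = rw p -> rw b = rw p ->
        (if r (rw p) == 1%R then nth 0 (map fst x) a < nth 0 (map fst x) b
         else nth 0 (map fst x) b < nth 0 (map fst x) a) ->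
        if r (rw p) == 1%R then nth 0 (map fst y) (f a) < nth 0 (map fst y) (f b)
         else nth 0 (map fst y) (f b) < nth 0 (map fst y) (f a).
      move=> Ea Eb; rewrite -!ltz_sign // => ab.
      have : before (inr (rw p)) (a : G) b by rewrite /before /on /= Ea Eb eqxx /=.
      move/fL => /and3P[/eqP /= Ea' /eqP /= Eb' ab'].
      by move: ab'; rewrite Ea' Eb'.
    case E: (r (rw p) == 1%R); first by have := H p q erefl (esym Er); rewrite E; apply.
    by have := H q p (esym Er) erefl; rewrite E; apply.
  rewrite -!point_value => pq.
  have [Hr Hr'] := (comp_row cx, comp_row cy).
  have [_ E1] := cellf p; have [_ E2] := cellf q; rewrite /= in E1 E2.
  have lt_row : rw p < rw q.
    rewrite ltn_neqAle; apply/andP; split; first by [].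
    rewrite leqNgt; apply/negP => qp.
    by have := incol_ltn (gridding_rows gx) (Hr q) (Hr p) qp; rewrite ltnNge ltnW.
  by apply: (incol_ltn (gridding_rows gy) (Hr' _) (Hr' _)); rewrite E1 E2.
have fp (p q : 'I_(size x)) : p < q -> (f p : 'I_(size y)) < (f q : 'I_(size y)).
  have [Ec|ne] := eqVneq (cl p) (cl q).
    move=> pq.
    have H a b : cl a = cl p -> cl b = cl p ->
        (if c (cl p) == 1%R then (a : 'I_(size x)) < (b : 'I_(size x)) else b < a) ->
        if c (cl p) == 1%R then (f a : 'I_(size y)) < (f b : 'I_(size y))
        else (f b : 'I_(size y)) < (f a : 'I_(size y)).
      move=> Ea Eb; rewrite -!ltz_sign // => ab.
      have : before (inl (cl p)) (a : G) b by rewrite /before /on /= Ea Eb eqxx /=.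
      move/fL => /and3P[/eqP /= Ea' /eqP /= Eb' ab'].
      by move: ab'; rewrite Ea' Eb'.
    case E: (c (cl p) == 1%R); first by have := H p q erefl (esym Ec); rewrite E; apply.
    by have := H q p (esym Ec) erefl; rewrite E; apply.
  move=> pq; have [Hc Hc'] := (comp_col cx, comp_col cy).
  have [E1 _] := cellf p; have [E2 _] := cellf q; rewrite /= in E1 E2.
  have lt_col : cl p < cl q.
    rewrite ltn_neqAle; apply/andP; split; first by [].
    rewrite leqNgt; apply/negP => qp.
    by have := incol_ltn (gridding_cols gx) (Hc q) (Hc p) qp; rewrite ltnNge ltnW.
  by apply: (incol_ltn (gridding_cols gy) (Hc' _) (Hc' _)); rewrite E1 E2.
exists f; split=> // [p q|p]; last by have [] := f1 p (in_setT _).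
apply/idP/idP => [|lt_f]; first exact: fv.
case: (ltngtP (point p).1 (point q).1) => // [/fv H|E].
  by rewrite ltnNge ltnW in lt_f.
have /val_inj E' : nat_of_ord p = q.
  by apply/eqP; rewrite -(nth_uniq 0 _ _ (is_perm_uniq px)) ?size_map // !point_value E.
by rewrite E' ltnn in lt_f.
Qed.

Lemma coils_bounded_lwqo (C : seq nat -> Prop) k : pseudoforest M -> perm_class C ->
  (forall s, C s -> in_grid M s) ->
  (forall s, C s -> is_coil M c r s -> size s <= k) -> lwqo C.
Proof.
move=> pf CC CM bnd L leL [qoL gL]; have [Cp _] := CC.
have trL a b d : leL a b -> leL b d -> leL a d by exact: qoL.2.
split; first exact: lcontained_qo.
move=> x Cx.
have /fun_choice[X HX] : forall i, exists X : lstr m n L, exists v h cl rw,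
   [/\ is_gridding M (map fst (x i)) v h, compatible (map fst (x i)) v h cl rw &
    X = @LStr _ _ _ (perm_grd c r (map fst (x i)) cl rw) setT (fun p => (point (x := x i) p).2)].
  move=> i; have [v [h gr]] := CM _ (Cx i).
  have [cl [rw cmp]] := compatible_exists (Cp _ (Cx i)) gr (size_map fst (x i)).
  by eexists; exists v, h, cl, rw.
(* The alphabet depends only on [m], [n] and the coil bound [k], so it serves the components of all
   members of [C] at once. *)
have gW := good_emb_encodable trL (@listed_sym m n k) (@forced_asym m n k) gL
  (M := M) (cellq := @lcell m n k).
have [i|i [j [ij E]]] := good_emb_components trL gW (M := M) (x := X).
  have [v [h [cl [rw [gr cmp ->]]]]] := HX i.
  have W : wf (perm_grd c r (map fst (x i)) cl rw) M := perm_wf pm (Cp _ (Cx i)) gr cmp.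
  have wb := perm_winding_bounded pm (Cp _ (Cx i)) gr cmp pf CC (Cx i) bnd.
  split=> // p pS; split=> //; apply: (strongly_connected_encodable pf W wb) => a b.
  exact: scc_connected.
exists i, j; split=> //.
have [v [h [cl [rw [gr cmp E1]]]]] := HX i; have [v' [h' [cl' [rw' [gr' cmp' E2]]]]] := HX j.
rewrite E1 E2 in E; exact: emb_lcontained (Cp _ (Cx i)) (Cp _ (Cx j)) gr gr' cmp cmp' E.
Qed.

End Main.

Theorem theorem4p1 (m n : nat) (M : 'M[int]_(m, n))
  (c : 'I_m -> int) (r : 'I_n -> int) (C : seq nat -> Prop) :
  gridding_matrix M -> pmm_with M c r -> pseudoforest M ->
  perm_class C -> (forall s, C s -> in_grid M s) ->
  (lwqo C <->
   exists k : nat, forall s, C s -> is_coil M c r s -> size s <= k).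
Proof.
move=> _ pm pf CC CM; split; first exact: lwqo_coils_bounded.
by case=> k; exact: coils_bounded_lwqo.
Qed.
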